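(* Let $\alpha\in(0,1)$ and let $\phi_\alpha(t)=t^{-1/(1+\alpha)}$. Then $\mathbf{P}$-almost surely, \[\limsup_{t\to\infty}\frac{p_t^\omega(0,0)}{\phi_\alpha(t)(\log\log t)^{\frac{1-\alpha}{1+\alpha}}}\in(0,\infty),\] and \[\liminf_{t\to\infty}\frac{p_t^\omega(0,0)\,(\log t)^{\theta}}{\phi_\alpha(t)}=0 \text{ if } \theta=\tfrac{1}{1+\alpha},\qquad \liminf_{t\to\infty}\frac{p_t^\omega(0,0)\,(\log t)^{\theta}}{\phi_\alpha(t)}=\infty \text{ if } \theta>\tfrac{3}{\alpha}.\]
   Context: One-dimensional symmetric Bouchaud trap model. Fix $\alpha>0$. Let $\tau=\{\tau_x\}_{x\in\mathbb{Z}}$ be i.i.d. random variables (the random environment, with law $\mathbf{P}$ and expectation $\mathbf{E}$; $\omega$ denotes a realisation of the environment) with $\mathbf{P}(\tau_x>u)=u^{-\alpha}$ for all $u\ge 1$. Given $\tau$, let $X=(X_t)_{t\ge0}$ be the continuous-time Markov chain on $\mathbb{Z}$ with generator $\mathcal{L}f(x)=\frac{1}{2\tau_x}\sum_{y\sim x}(f(y)-f(x))$ (sum over the two nearest neighbours of $x$); i.e. $X$ waits at $x$ an exponential time with mean $\tau_x$ and then jumps to a uniformly chosen neighbour. Write $P^\omega_x$ for the quenched law of $X$ started at $x$. The measure $\sum_x\tau_x\delta_x$ is reversible/invariant for $X$, and the quenched heat kernel is $p_t^\omega(x,y)=P^\omega_x(X_t=y)/\tau_y$. *)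

(* Defs.v *)
From HB Require Import structures.
From mathcomp Require Import all_boot all_order all_algebra.
From mathcomp Require Import all_classical all_reals all_analysis.
Set Implicit Arguments. Unset Strict Implicit. Unset Printing Implicit Defensive.
Import Order.TTheory GRing.Theory Num.Theory.
Import numFieldNormedType.Exports.
Local Open Scope classical_set_scope.
Local Open Scope ring_scope.

Definition mutually_independent_rvs {d} {Omega : measurableType d}
  {R : realType} (P : probability Omega R) (X : int -> Omega -> R) : Prop :=
  forall (s : seq int), uniq s ->
  forall (B : int -> set R), (forall i, measurable (B i)) ->
  P (\big[setI/setT]_(i <- s) (X i @^-1` B i)) =
    (\prod_(i <- s) P (X i @^-1` B i))%E.

Definition bouchaud_gen {R : realType} (tau : int -> R) (f : int -> R)
  : int -> R :=
  fun x => (2 * tau x)^-1 * ((f (x + 1)%R - f x) + (f (x - 1)%R - f x)).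

Definition site_ind {R : realType} (y : int) : int -> R :=
  fun x => if x == y then 1 else 0.

(* Quenched transition probability P^omega_x (X_t = y) = (e^{tL} 1_y)(x).
   Since tau >= 1 the generator is bounded (rates <= 1), so the semigroup is
   the exponential series, which converges absolutely. *)
Definition bouchaud_trans {R : realType} (tau : int -> R) (t : R)
  (x y : int) : R :=
  limn (fun N => \sum_(0 <= n < N)
          (t ^+ n / (n`!)%:R * iter n (bouchaud_gen tau) (site_ind y) x)).

Definition heat_kernel {R : realType} (tau : int -> R) (t : R) (x y : int) : R :=
  bouchaud_trans tau t x y / tau y.

Definition limsup_pinfty {R : realType} (f : R -> R) : \bar R :=
  limf_esup (fun t => (f t)%:E) (pinfty_nbhs R).
Definition liminf_pinfty {R : realType} (f : R -> R) : \bar R :=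
  limf_einf (fun t => (f t)%:E) (pinfty_nbhs R).

(* Main.v *)
(** The walk is discretised by a half-lazy chain Q with generator 2(Q - 1),
    whose return densities a_n are nonincreasing and whose Poissonisation is
    p_t(0,0).  Let V(r) be the volume of [0,r) and W(r) that of [-r,r).  Since
    the resistance of a segment is its length,

      p_t(0,0) <= 2 / V(r) + 130 r / t             for all r >= 1, t >= 8,
      p_t(0,0) >= 1 / (32 W(4r))                   whenever 2t + 1 <= r V(r).

    The first bound is a pigeonhole on the Dirichlet energy.  The second pairs
    the density with a superposition h of tents, which satisfies (1 - Q) h <= 1,
    so that <q_n, h> decreases by at most 1 per step, and then uses Cauchy-Schwarz.

    It remains to know the volumes at dyadic radii r = 2^m.  Almost surely, with
    constants omitted,

      V(r) >= r^(1/alpha) (ln m)^(1 - 1/alpha)          eventually,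
      W(r) <= r^(1/alpha) (ln m)^(1 - 1/alpha)          infinitely often,
      V(r) >= M (r m)^(1/alpha)                         infinitely often, for every M,
      W(r) <= r^(1/alpha) m^(2/alpha) ln m              eventually.

    The eventual bounds are exponential Markov inequalities for functions of
    finitely many levels of tau; the recurrent ones are a second Borel-Cantelli
    argument for the maxima of tau over disjoint blocks.  Optimising r in the
    heat kernel bounds gives the four claims. *)
Require Import Defs.
From HB Require Import structures.
From mathcomp Require Import all_boot all_order all_algebra.
From mathcomp Require Import all_classical all_reals all_analysis.
From mathcomp Require Import measurable_realfun.
From mathcomp Require Import ring lra zify.
Import Order.TTheory GRing.Theory Num.Theory.
Import numFieldNormedType.Exports.
Local Open Scope classical_set_scope.
Local Open Scope ring_scope.


(** * Finite sums over integer windows *)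

(** One scaling fixes the exponents: for V(r) of order r^(1/alpha), the two heat kernel bounds
    balance at r V(r) = t, that is at r = t^(alpha/(1+alpha)), where r / t = t^(-1/(1+alpha)). A
    loss of (ln m)^(1 - 1/alpha) in the volume, with m of order ln t, moves this balance by the
    power (1-alpha)/(1+alpha) of ln ln t. The threshold 3/alpha is a sum: 2/alpha from the eventual
    bound on W, and 1/alpha from a radius enlarged by the factor ln t so that 2t + 1 <= r V(r) holds
    with room to spare.

    As alpha < 1, the tau have infinite mean and a sum is governed by its largest terms. Upper
    bounds on volumes therefore treat separately the event that no site exceeds a level L and the
    sum of min(tau / L, 1), which has exponential moments. Volumes of nested windows are not
    independent; the recurrent small values of W use annuli between the radii 2^(n^2), which grow so
    fast that the inner window is negligible even with its eventual bound. *)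

Definition window (N : nat) : seq int :=
  [seq i%:Z - N%:Z | i <- iota 0 (N + N)].
Definition pwindow (N : nat) : seq int := [seq i%:Z | i <- iota 0 N].

Lemma mem_window N x : (x \in window N) = (- N%:Z <= x < N%:Z).
Proof.
apply/mapP/idP => [[i]|xN].
  rewrite mem_iota => iN ->; lia.
exists (absz (x + N%:Z)); last by lia.
rewrite mem_iota; lia.
Qed.

Lemma mem_pwindow N x : (x \in pwindow N) = (0 <= x < N%:Z).
Proof.
apply/mapP/idP => [[i]|xN].
  rewrite mem_iota => iN ->; lia.
exists (absz x); last by lia.
rewrite mem_iota; lia.
Qed.

Lemma window_uniq N : uniq (window N).
Proof. by rewrite map_inj_uniq ?iota_uniq// => i j; lia. Qed.

Lemma pwindow_uniq N : uniq (pwindow N).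
Proof. by rewrite map_inj_uniq ?iota_uniq// => i j []. Qed.

Lemma size_window N : size (window N) = N.*2.
Proof. by rewrite size_map size_iota addnn. Qed.

Lemma size_pwindow N : size (pwindow N) = N.
Proof. by rewrite size_map size_iota. Qed.

Section FiniteSums.
Variables (R : realFieldType) (I : eqType).

Lemma ler_sum_subseq (s1 s2 : seq I) (F : I -> R) :
  uniq s1 -> uniq s2 -> {subset s1 <= s2} ->
  {in s2, forall x, 0 <= F x} ->
  \sum_(x <- s1) F x <= \sum_(x <- s2) F x.
Proof.
move=> u1 u2 sub F0.
rewrite [leRHS](bigID (mem s1))/= -[X in _ <= X + _]big_filter.
have p : perm_eq [seq x <- s2 | x \in s1] s1.
  apply: uniq_perm => //; first exact: filter_uniq.
  by move=> x; rewrite mem_filter andbC; apply: andb_idl => /sub.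
rewrite (perm_big _ p)/= lerDl big_seq_cond sumr_ge0// => x /andP[+ _].
exact: F0.
Qed.

Lemma cauchy_schwarz_sum (s : seq I) (w f g : I -> R) :
  (forall x, 0 <= w x) ->
  (\sum_(x <- s) w x * f x * g x) ^+ 2 <=
  (\sum_(x <- s) w x * f x * f x) * (\sum_(x <- s) w x * g x * g x).
Proof.
move=> w0; elim: s => [|x s IH]; first by rewrite !big_nil expr0n mul0r.
rewrite !big_cons.
set A := \sum_(_ <- s) _ in IH *; set B := \sum_(_ <- s) _ in IH *.
set C := \sum_(_ <- s) _ in IH *.
have B0 : 0 <= B by apply: sumr_ge0 => i _; rewrite -mulrA mulr_ge0 ?sqr_ge0.
have C0 : 0 <= C by apply: sumr_ge0 => i _; rewrite -mulrA mulr_ge0 ?sqr_ge0.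
move: (f x) (g x) (w x) (w0 x) => a b v v0.
(* Compare squares: (B b^2 + C a^2)^2 - (2 A a b)^2 is the square of B b^2 - C a^2 plus 4 (B C -
   A^2) (a b)^2. *)
have key : 2 * A * a * b <= B * b ^+ 2 + C * a ^+ 2.
  apply: le_trans (ler_norm _) _.
  have h0 : 0 <= B * b ^+ 2 + C * a ^+ 2 by rewrite addr_ge0// mulr_ge0// sqr_ge0.
  rewrite -(@ler_pXn2r _ 2) ?nnegrE// real_normK ?num_real//.
  have h1 : 0 <= (B * b ^+ 2 - C * a ^+ 2) ^+ 2 by rewrite sqr_ge0.
  have h2 : 0 <= (B * C - A ^+ 2) * (a * b) ^+ 2.
    by rewrite mulr_ge0 ?sqr_ge0// subr_ge0.
  rewrite -subr_ge0 [leRHS](_ : _ = (B * b ^+ 2 - C * a ^+ 2) ^+ 2 +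
    4 * ((B * C - A ^+ 2) * (a * b) ^+ 2)); last by ring.
  by rewrite addr_ge0// mulr_ge0.
have h := ler_wpM2l v0 key.
rewrite -subr_ge0 [leRHS](_ : _ = (B * C - A ^+ 2) +
  (v * (B * b ^+ 2 + C * a ^+ 2) - v * (2 * A * a * b))); last by ring.
by rewrite addr_ge0// subr_ge0.
Qed.

End FiniteSums.

(** * The lazy discretisation *)

Section LazyWalk.
Variable R : realFieldType.
Implicit Types f g : int -> R.

Definition grad f (x : int) : R := f (x + 1) - f x.
Definition lap f (x : int) : R := (f (x + 1) - f x) + (f (x - 1) - f x).
(** Windows are half-open, whereas the support is strict on both sides: [f] vanishes at [- N] and at
    [N], so shifting the window by one leaves no boundary term. *)
Definition supported (N : nat) f :=
  forall x : int, ~~ (- N%:Z < x < N%:Z) -> f x = 0.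

Lemma supportedW M N f : (M <= N)%N -> supported M f -> supported N f.
Proof. by move=> MN sf x xN; apply: sf; lia. Qed.

Lemma sum_window_shift N f :
  \sum_(x <- window N) f (x + 1) = \sum_(x <- window N) f x + (f N%:Z - f (- N%:Z)).
Proof.
apply/eqP; rewrite addrC -subr_eq -sumrB big_map -[X in iota _ X]subn0 -/(index_iota 0 (N + N)).
rewrite (eq_big_nat _ _ (F2 := fun i => f (i.+1%:Z - N%:Z) - f (i%:Z - N%:Z))); last first.
  by move=> i _; congr (f _ - _); lia.
rewrite telescope_sumr//; apply/eqP; congr (f _ - f _); lia.
Qed.

Lemma sum_window_supported N f : supported N f ->
  \sum_(x <- window N) f (x + 1) = \sum_(x <- window N) f x.
Proof. by move=> sf; rewrite sum_window_shift !sf ?subr0 ?addr0//; lia. Qed.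

Lemma sum_window_widen M N f : (M <= N)%N -> supported M f ->
  \sum_(x <- window N) f x = \sum_(x <- window M) f x.
Proof.
move=> MN sf.
rewrite -(@big_rmcond _ _ _ _ _ (mem (window M)))/=; last first.
  by move=> x; rewrite mem_window => xM; apply: sf; lia.
rewrite -big_filter; apply: perm_big; apply: uniq_perm.
- exact/filter_uniq/window_uniq.
- exact: window_uniq.
by move=> x; rewrite mem_filter !mem_window; lia.
Qed.

Lemma sum_by_parts N f g : supported N f ->
  \sum_(x <- window N) f x * lap g x = - \sum_(x <- window N) grad f x * grad g x.
Proof.
move=> sf.
have -> : \sum_(x <- window N) f x * lap g x =
    \sum_(x <- window N) f x * grad g x - \sum_(x <- window N) f x * grad g (x - 1).
  by rewrite -sumrB; apply: eq_bigr => x _; rewrite /lap /grad subrK; ring.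
rewrite -(@sum_window_supported _ (fun x => f x * grad g (x - 1))); last first.
  by move=> x /sf ->; rewrite mul0r.
rewrite -sumrB -sumrN; apply: eq_bigr => x _.
by rewrite addrK /grad; ring.
Qed.

(** Conservation of mass. The strict [M < N] leaves room for the support of the translate
    [f (x - 1)]. *)
Lemma sum_lap M N f : (M < N)%N -> supported M f ->
  \sum_(x <- window N) lap f x = 0.
Proof.
move=> MN sf.
have sN : supported N f := supportedW _ _ _ (ltnW MN) sf.
rewrite /lap big_split/= !sumrB sum_window_supported//.
rewrite -(@sum_window_supported N (fun x => f (x - 1))); last first.
  by move=> x xN; apply: sf; lia.
under [X in _ + (X - _)]eq_bigr do rewrite addrK.
by rewrite subrr addr0.
Qed.

Variable tau : int -> R.
Hypothesis tau_ge1 : forall x, 1 <= tau x.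

Let tau_gt0 x : 0 < tau x. Proof. exact: lt_le_trans (tau_ge1 x). Qed.
Let tau_neq0 x : tau x != 0. Proof. by rewrite gt_eqF. Qed.

(* A half-lazy discretisation: the generator is [2 (step - id)], and the
   laziness makes [step] a nonnegative self-adjoint operator. *)
Definition step f (x : int) : R := f x + (4 * tau x)^-1 * lap f x.
Definition inner N f g : R := \sum_(x <- window N) tau x * f x * g x.
(* The density [q_n(0,x) = P_0(X_n = x) / tau x] of the discrete chain. *)
Definition dens (n : nat) : int -> R :=
  iter n step (fun x => if x == 0 then (tau 0)^-1 else 0).
Definition retp n : R := dens n 0.

Lemma supported_step N f : supported N f -> supported N.+1 (step f).
Proof. by move=> sf x xN; rewrite /step /lap !sf; lia || ring. Qed.

Lemma supported_dens n : supported n.+1 (dens n).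
Proof.
elim: n => [|n IH] /=; last exact: supported_step.
by move=> x /=; case: eqP => // ->; lia.
Qed.

Lemma innerC N f g : inner N f g = inner N g f.
Proof. by apply: eq_bigr => x _; ring. Qed.

Lemma inner_step N f g : supported N f ->
  inner N f (step g) = inner N f g - 4^-1 * \sum_(x <- window N) grad f x * grad g x.
Proof.
move=> sf; rewrite -mulrN -sum_by_parts// /inner mulr_sumr -big_split/=.
by apply: eq_bigr => x _; rewrite /step; field; rewrite tau_neq0.
Qed.

Lemma inner_stepC N f g : supported N f -> supported N g ->
  inner N (step f) g = inner N f (step g).
Proof.
move=> sf sg; rewrite innerC !inner_step// innerC; congr (_ - _ * _).
by apply: eq_bigr => x _; rewrite mulrC.
Qed.

Lemma inner_dens0 N g : (0 < N)%N -> inner N (dens 0) g = g 0.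
Proof.
move=> N0; rewrite /inner (bigD1_seq 0) ?window_uniq//=; last by rewrite mem_window; lia.
rewrite big1 ?addr0; last by move=> x /negbTE ->; ring.
by field; rewrite tau_neq0.
Qed.

(** Self-adjointness of [step] moves the steps from left to right one at a time. Return densities
    thus become quadratic forms in [dens m], which gives both their monotonicity and the energy
    identity. *)
Lemma inner_dens N m n : (m + n < N)%N -> inner N (dens m) (dens n) = retp (m + n).
Proof.
elim: m n => [|m IH] n mnN; first by rewrite inner_dens0//; lia.
rewrite [dens m.+1]/(step (dens m)) inner_stepC; last 2 first.
- by apply: supportedW (supported_dens m); lia.
- by apply: supportedW (supported_dens n); lia.
by rewrite (IH n.+1) ?addSnnS//; lia.
Qed.

Lemma retp_energy N m : (m.*2 < N)%N ->
  retp m.*2 - retp m.*2.+1 = 4^-1 * \sum_(x <- window N.+1) grad (dens m) x ^+ 2.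
Proof.
move=> mN; rewrite -addnn -addnS -!(@inner_dens N.+1); try lia.
rewrite [dens m.+1]/(step (dens m)) inner_step; last first.
  by apply: supportedW (supported_dens m); lia.
by under eq_bigr do rewrite -expr2; ring.
Qed.

Lemma retp_even_ge m : retp m.*2.+1 <= retp m.*2.
Proof.
rewrite -subr_ge0 (@retp_energy m.*2.+1)// mulr_ge0// ?invr_ge0//.
by apply: sumr_ge0 => x _; exact: sqr_ge0.
Qed.

(* With [Qf = f - g], [<f,Qf> - <Qf,Qf> = <f,g> - <g,g>] and
   [(lap f)^2 <= 2 (grad f)^2 + 2 (grad f (- 1))^2]. *)
Lemma inner_step_contract N f : supported N f ->
  inner N (step f) (step f) <= inner N f (step f).
Proof.
move=> sf.
have h1 : inner N f (step f) - inner N (step f) (step f) =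
    4^-1 * \sum_(x <- window N) grad f x ^+ 2 -
    16^-1 * \sum_(x <- window N) (tau x)^-1 * lap f x ^+ 2.
  have -> : \sum_(x <- window N) grad f x ^+ 2 = - \sum_(x <- window N) f x * lap f x.
    by rewrite sum_by_parts// opprK; apply: eq_bigr => x _; rewrite expr2.
  rewrite mulrN -opprD !mulr_sumr -sumrB -big_split/= -sumrN.
  by apply: eq_bigr => x _; rewrite /step; field; rewrite tau_neq0.
rewrite -subr_ge0 h1 subr_ge0.
(* The factor 4 is exactly what [h1] can absorb, as 4 / 16 = 1 / 4; it relies on [1 <= tau x]. *)
have h2 : \sum_(x <- window N) (tau x)^-1 * lap f x ^+ 2 <=
    4 * \sum_(x <- window N) grad f x ^+ 2.
  have hs : \sum_(x <- window N) grad f (x - 1) ^+ 2 <= \sum_(x <- window N) grad f x ^+ 2.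
    have := sum_window_shift N (fun x => grad f (x - 1) ^+ 2).
    under eq_bigr do rewrite addrK.
    move=> ->; rewrite lerDl subr_ge0 [X in X ^+ 2 <= _](_ : _ = 0) ?expr0n ?sqr_ge0//.
    by rewrite /grad !sf ?subrr//; lia.
  apply: le_trans (_ : 2 * \sum_(x <- window N) grad f x ^+ 2 +
                       2 * \sum_(x <- window N) grad f (x - 1) ^+ 2 <= _).
    rewrite !mulr_sumr -big_split/=; apply: ler_sum => x _.
    have lq : lap f x ^+ 2 <= 2 * grad f x ^+ 2 + 2 * grad f (x - 1) ^+ 2.
      have -> : lap f x = grad f x - grad f (x - 1) by rewrite /lap /grad subrK; ring.
      by have := sqr_ge0 (grad f x + grad f (x - 1)); nra.
    apply: le_trans lq; rewrite ler_piMl ?sqr_ge0// invf_le1//.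
  lra.
lra.
Qed.

Lemma retp_odd_ge m : retp m.*2.+2 <= retp m.*2.+1.
Proof.
have -> : m.*2.+2 = (m.+1 + m.+1)%N by lia.
have -> : m.*2.+1 = (m + m.+1)%N by lia.
rewrite -!(@inner_dens (m.*2.+3)); try lia.
apply: inner_step_contract; apply: supportedW (supported_dens m); lia.
Qed.

Lemma retp_noninc m n : (m <= n)%N -> retp n <= retp m.
Proof.
elim: n => [|n IH] mn; first by have -> : m = 0 by lia.
case: (leqP m n) => [/IH|nm]; last by have -> : m = n.+1 by lia.
apply: le_trans; rewrite -(odd_double_half n); case: (odd n) => /=.
  by rewrite add1n; exact: retp_odd_ge.
by rewrite add0n; exact: retp_even_ge.
Qed.

Lemma dens_ge0 n x : 0 <= dens n x.
Proof.
elim: n x => [|n IH] x /=.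
  by case: ifP => _ //; rewrite invr_ge0 ltW.
rewrite /step /lap.
have -> : dens n x + (4 * tau x)^-1 * (dens n (x + 1) - dens n x + (dens n (x - 1) - dens n x))
  = (1 - (2 * tau x)^-1) * dens n x + (4 * tau x)^-1 * (dens n (x + 1) + dens n (x - 1)).
  by field; rewrite tau_neq0.
have t1 := tau_ge1 x.
apply: addr_ge0; apply: mulr_ge0 => //.
- by rewrite subr_ge0 invf_le1; lra.
- by rewrite invr_ge0; lra.
- exact: addr_ge0.
Qed.

Lemma retp_ge0 n : 0 <= retp n. Proof. exact: dens_ge0. Qed.

Lemma retp_le1 n : retp n <= 1.
Proof. by apply: le_trans (retp_noninc _ _ (leq0n n)) _; rewrite /retp /= invf_le1. Qed.

Lemma sum_dens N n : (n.+1 < N)%N -> \sum_(x <- window N) tau x * dens n x = 1.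
Proof.
elim: n => [|n IH] nN.
  have := @inner_dens0 N (fun=> 1) ltac:(lia); rewrite /inner => <-.
  by apply: eq_bigr => x _; rewrite mulr1.
transitivity (\sum_(x <- window N) tau x * dens n x +
              4^-1 * \sum_(x <- window N) lap (dens n) x); last first.
  rewrite (@sum_lap n.+1) ?mulr0 ?addr0 ?IH//; try lia.
  exact: supported_dens.
rewrite mulr_sumr -big_split/=; apply: eq_bigr => x _.
by rewrite /step; field; rewrite tau_neq0.
Qed.

(** * Volumes and the upper bound on return densities *)

Definition vol r : R := \sum_(x <- pwindow r) tau x.
Definition bivol r : R := \sum_(x <- window r) tau x.

Lemma vol_ge r : r%:R <= vol r.
Proof.
rewrite /vol -[X in X%:R](size_pwindow r) -sum1_size natr_sum.
by apply: ler_sum => x _.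
Qed.

Lemma vol_gt0 r : (0 < r)%N -> 0 < vol r.
Proof. by move=> r0; apply: lt_le_trans (vol_ge r); rewrite ltr0n. Qed.

Lemma bivol_gt0 r : (0 < r)%N -> 0 < bivol r.
Proof.
move=> r0; apply: lt_le_trans (vol_gt0 _ r0) _; apply: ler_sum_subseq.
- exact: pwindow_uniq.
- exact: window_uniq.
- by move=> x; rewrite mem_pwindow mem_window; lia.
- by move=> x _; exact: ltW.
Qed.

(** Cauchy-Schwarz for the increments along the path from 0 to [i]; the factor [i] is the resistance
    of that path. *)
Lemma grad_sum_sq N f i : (i <= N)%N ->
  (f 0 - f i%:Z) ^+ 2 <= i%:R * \sum_(x <- window N) grad f x ^+ 2.
Proof.
move=> iN.
have -> : f 0 - f i%:Z = - \sum_(x <- pwindow i) 1 * 1 * grad f x.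
  rewrite big_map -[X in iota _ X]subn0 -/(index_iota 0 i).
  rewrite (eq_big_nat _ _ (F2 := fun j => f j.+1%:Z - f j%:Z)); last first.
    by move=> j _; rewrite !mul1r /grad; congr (f _ - _); lia.
  by rewrite telescope_sumr// opprB.
rewrite sqrrN; apply: le_trans (@cauchy_schwarz_sum _ _ _ (fun=> 1) _ _ _) _ => //.
under eq_bigr do rewrite !mulr1.
rewrite big_const_seq count_predT size_pwindow iter_addr_0 ler_wpM2l//.
under eq_bigr do rewrite mul1r -expr2.
apply: ler_sum_subseq => //.
- exact: pwindow_uniq.
- exact: window_uniq.
- by move=> x; rewrite mem_pwindow mem_window; lia.
- by move=> x _; exact: sqr_ge0.
Qed.

Lemma sum_dens_le1 r n : \sum_(x <- pwindow r) tau x * dens n x <= 1.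
Proof.
rewrite -(@sum_dens (r + n).+2 n); last by lia.
apply: ler_sum_subseq.
- exact: pwindow_uniq.
- exact: window_uniq.
- by move=> x; rewrite mem_pwindow mem_window; lia.
- by move=> x _; rewrite mulr_ge0 ?dens_ge0 ?ltW.
Qed.

(** Otherwise the chain would have mass more than 1 in [0,r). *)
Lemma dens_le_inv_vol r n : (0 < r)%N ->
  exists2 i, (i < r)%N & dens n i%:Z <= (vol r)^-1.
Proof.
move=> r0; have V0 := vol_gt0 _ r0.
have [/hasP[i]|/hasPn h] := boolP (has (fun i : nat => dens n i%:Z <= (vol r)^-1) (iota 0 r)).
  by rewrite mem_iota => ir; exists i.
have : \sum_(x <- pwindow r) tau x * (vol r)^-1 < \sum_(x <- pwindow r) tau x * dens n x.
  rewrite !big_map; rewrite big_seq [ltRHS]big_seq; apply: ltr_sum => [|x /h].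
    by apply/hasP; exists 0; rewrite mem_iota.
  by rewrite -ltNge ltr_pM2l.
rewrite -mulr_suml mulfV ?gt_eqF// => hlt.
by have := lt_le_trans hlt (sum_dens_le1 r n); rewrite ltxx.
Qed.

(* Some [E(dens m)] with [k <= m < 2k] is at most [retp (2k) / k], and [dens m]
   is at most [1 / vol r] at some point of [0,r). *)
Lemma retp_upper r k : (0 < r)%N -> (0 < k)%N ->
  retp k.*2 <= 2 / vol r + 16 * r%:R / k%:R.
Proof.
move=> r0 k0; have V0 := vol_gt0 _ r0.
have kR : 0 < k%:R :> R by rewrite ltr0n.
set A := retp k.*2.
have [m mk Em] : exists2 m, (k <= m < k.*2)%N & retp m.*2 - retp m.*2.+1 <= A / k%:R.
  have [/hasP[m]|/hasPn h] := boolP (has (fun m => retp m.*2 - retp m.*2.+1 <= A / k%:R) (iota k k)).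
    by rewrite mem_iota => mk hm; exists m => //; lia.
  (* Otherwise the [k] drops of [retp] from 2m to 2m + 2 telescope to more than [A], although they
     start at [A] and [retp] stays nonnegative. *)
  exfalso.
  have h1 : \sum_(m <- iota k k) (A / k%:R) < \sum_(m <- iota k k) (retp m.*2 - retp m.*2.+2).
    apply: (@lt_le_trans _ _ (\sum_(m <- iota k k) (retp m.*2 - retp m.*2.+1))).
      rewrite !big_seq; apply: ltr_sum => [|m /h]; last by rewrite -ltNge.
      by apply/hasP; exists k; rewrite ?mem_iota; lia.
    by apply: ler_sum => m _; rewrite lerD2l lerN2 retp_odd_ge.
  have h2 : \sum_(m <- iota k k) (retp m.*2 - retp m.*2.+2) = A - retp (k + k).*2.
    have -> : iota k k = index_iota k (k + k) by rewrite /index_iota addnK.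
    rewrite (eq_big_nat _ _ (F2 := fun m => - retp m.+1.*2 - - retp m.*2)); last first.
      by move=> m _; rewrite doubleS opprK addrC.
    by rewrite (telescope_sumr (fun m => - retp m.*2)) ?leq_addr// opprK addrC.
  have h3 : \sum_(m <- iota k k) (A / k%:R) = A.
    rewrite big_const_seq count_predT size_iota iter_addr_0 -mulr_natr.
    by field; rewrite gt_eqF.
  by move: h1; rewrite h2 h3; have := retp_ge0 (k + k).*2; lra.
have [i ir hi] := dens_le_inv_vol r m r0.
set N := (m.*2 + i).+1.
have hg := grad_sum_sq N.+1 (dens m) i ltac:(lia).
have he := retp_energy N m ltac:(lia).
have Am : A <= dens m 0 by apply: retp_noninc; lia.
(* In the second case [dens m] falls by at least A / 2 between 0 and [i], so that (A / 2)^2 <= 4 r A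
   / k, that is A <= 16 r / k. *)
have [Ale|Age] := leP A (2 / vol r).
  by apply: le_trans Ale _; rewrite lerDl divr_ge0 ?mulr_ge0.
have A0 : 0 < A by apply: lt_trans Age; rewrite divr_gt0.
have h4 : (A / 2) ^+ 2 <= (dens m 0 - dens m i%:Z) ^+ 2.
  rewrite ler_pXn2r// ?nnegrE; lra.
have h5 : (A / 2) ^+ 2 <= r%:R * (4 * (A / k%:R)).
  apply: le_trans h4 (le_trans hg _).
  apply: ler_pM => //; first by apply: sumr_ge0 => x _; exact: sqr_ge0.
    by rewrite ler_nat ltnW.
  by move: he Em; lra.
apply: (@le_trans _ _ (16 * r%:R / k%:R)); last by rewrite lerDr divr_ge0// ltW.
rewrite -(ler_pM2l A0).
have -> : A * (16 * r%:R / k%:R) = 4 * (r%:R * (4 * (A / k%:R))) by ring.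
lra.
Qed.

(* A superposition of symmetric tents: [lap] of the tent of radius [2r] at [y]
   is at least [-2] at [y] and nonnegative elsewhere, so that
   [tau * (id - step) (testfn r) <= tau] pointwise. *)
Definition tent (r : nat) (z : int) : R := Num.max 0 ((2 * r)%:R - `|z|%:~R).
Definition testfn r (x : int) : R := \sum_(y <- pwindow r) 2 * tau y * tent r (x - y).

Lemma tent_ge0 r z : 0 <= tent r z.
Proof. by rewrite /tent le_max lexx. Qed.

Lemma tent_le r z : tent r z <= (2 * r)%:R.
Proof. by rewrite /tent ge_max ler0n gerBl ler0z normr_ge0. Qed.

Lemma tent_lap r (z : int) : (0 < r)%N -> - 2 * (z == 0)%:R <= lap (tent r) z.
Proof.
move=> r0.
(* The tent takes integer values, so the inequality is decided over the integers. *)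
have E w : tent r w = (Num.max 0 ((2 * r)%:Z - `|w|))%:~R.
  rewrite /tent -[(2 * r)%:R]/((2 * r)%:Z%:~R) -intrB -[X in Num.max X _]/(0%:Z%:~R).
  by rewrite /Num.max /Num.max !ltr_int; case: (_ < _).
rewrite /lap !E -!intrB -intrD.
have -> : - 2 * (z == 0)%:R = (- 2%:Z * (z == 0)%:Z)%:~R :> R.
  by rewrite intrM mulrNz; case: (z == 0).
rewrite ler_int; case: eqP; lia.
Qed.

Lemma testfn_ge0 r x : 0 <= testfn r x.
Proof. by apply: sumr_ge0 => y _; rewrite mulr_ge0 ?tent_ge0// mulr_ge0// ltW. Qed.

Lemma testfn_le r x : testfn r x <= 4 * r%:R * vol r.
Proof.
rewrite /vol mulr_sumr; apply: ler_sum => y _.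
have -> : 4 * r%:R * tau y = 2 * tau y * (2 * r)%:R by rewrite natrM; ring.
by rewrite ler_wpM2l ?tent_le// mulr_ge0// ltW.
Qed.

(** The radius [2 * r] of the tents is chosen so that each one centred in [0,r) still has height at
    least [r] at 0. *)
Lemma testfn0_ge r : 2 * r%:R * vol r <= testfn r 0.
Proof.
rewrite /vol mulr_sumr big_seq [leRHS]big_seq; apply: ler_sum => y.
rewrite mem_pwindow => yr.
have -> : 2 * r%:R * tau y = 2 * tau y * r%:R by ring.
rewrite ler_wpM2l ?mulr_ge0 ?(ltW (tau_gt0 _))// /tent le_max; apply/orP; right.
rewrite sub0r normrN -[r%:R]/(r%:Z%:~R) -[(2 * r)%:R]/((2 * r)%:Z%:~R) -intrB ler_int.
lia.
Qed.

Lemma supported_testfn r : supported (4 * r) (testfn r).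
Proof.
move=> x xr; rewrite /testfn big_seq big1// => y; rewrite mem_pwindow => yr.
rewrite /tent max_l ?mulr0// -[(2 * r)%:R]/((2 * r)%:Z%:~R) -intrB.
rewrite -[0]/(0%:Z%:~R) ler_int; lia.
Qed.

Lemma testfn_lap r (x : int) : (0 < r)%N -> - 4 * tau x <= lap (testfn r) x.
Proof.
move=> r0.
have -> : lap (testfn r) x = \sum_(y <- pwindow r) 2 * tau y * lap (tent r) (x - y).
  rewrite /lap /testfn -!sumrB -big_split/=; apply: eq_bigr => y _.
  have -> : x + 1 - y = x - y + 1 by ring.
  have -> : x - 1 - y = x - y - 1 by ring.
  by ring.
apply: (@le_trans _ _ (- 4 * \sum_(y <- pwindow r) if y == x then tau y else 0)).
  apply: ler_wnM2l; first lra.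
  have [xr|xr] := boolP (x \in pwindow r).
    by rewrite (bigD1_seq x) ?pwindow_uniq//= eqxx big1 ?addr0// => y /negbTE ->.
  rewrite big_seq big1 ?ltW// => y yr; case: eqP => // yx.
  by move: xr; rewrite -yx yr.
rewrite mulr_sumr; apply: ler_sum => y _.
have -> : - 4 * (if y == x then tau y else 0) = 2 * tau y * (- 2 * (x - y == 0)%:R).
  by rewrite subr_eq0 eq_sym; case: eqP => _ /=; rewrite ?mulr1n ?mulr0n; ring.
by rewrite ler_wpM2l ?mulr_ge0 ?(ltW (tau_gt0 _))// tent_lap.
Qed.

Lemma inner_testfn_ge r N n : (0 < r)%N -> (4 * r <= N)%N -> (n.+1 < N)%N ->
  testfn r 0 - n%:R <= inner N (dens n) (testfn r).
Proof.
move=> r0 rN; elim: n => [|n IH] nN; first by rewrite inner_dens0 ?subr0//; lia.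
rewrite [dens n.+1]/(step (dens n)) inner_stepC; last 2 first.
- by apply: supportedW (supported_dens n); lia.
- exact: supportedW (supported_testfn r).
apply: (@le_trans _ _ (inner N (dens n) (testfn r) - \sum_(x <- window N) tau x * dens n x)).
  by rewrite sum_dens// -?natr1; have := IH ltac:(lia); lra || lia.
rewrite -sumrB; apply: ler_sum => x _.
rewrite /step mulrDr lerD2l.
have -> : - (tau x * dens n x) = dens n x * (- 4 * tau x) / 4 by field.
have -> : tau x * dens n x * ((4 * tau x)^-1 * lap (testfn r) x) =
   dens n x * lap (testfn r) x / 4 by field; rewrite tau_neq0.
by have := ler_wpM2l (dens_ge0 n x) (testfn_lap r x r0); lra.
Qed.

Lemma retp_lower r n : (0 < r)%N -> n%:R <= r%:R * vol r ->
  (16 * bivol (4 * r))^-1 <= retp n.*2.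
Proof.
move=> r0 nr; have V0 := vol_gt0 _ r0; have W0 := bivol_gt0 (4 * r) ltac:(lia).
have rR : 0 < r%:R :> R by rewrite ltr0n.
set N := (4 * r + n.*2).+2.
(* The pairing starts at 2 r V(r) or more, and the n <= r V(r) steps consume at most half of it. *)
have h1 : r%:R * vol r <= inner N (dens n) (testfn r).
  apply: le_trans (inner_testfn_ge _ _ _ r0 _ _); try by rewrite /N; lia.
  have := testfn0_ge r; lra.
have h2 := @cauchy_schwarz_sum _ _ (window N) tau (dens n) (testfn r) ltac:(move=> x; exact: ltW).
have h3 : inner N (testfn r) (testfn r) <= (4 * r%:R * vol r) ^+ 2 * bivol (4 * r).
  rewrite /inner (@sum_window_widen (4 * r)); last 2 first.
  - by rewrite /N; lia.
  - by move=> x /supported_testfn ->; rewrite mulr0.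
  rewrite /bivol mulr_sumr; apply: ler_sum => x _.
  rewrite -mulrA mulrC ler_wpM2r ?(ltW (tau_gt0 _))// -expr2.
  by rewrite ler_pXn2r// ?nnegrE ?testfn_ge0 ?testfn_le// !mulr_ge0 ?ltW.
rewrite -!/(inner N _ _) inner_dens in h2; last by rewrite /N; lia.
(* The height of [testfn] is comparable to its value at 0, so r V(r) cancels and only 4^2 and the
   volume of its support remain. *)
have h4 : (r%:R * vol r) ^+ 2 <= retp (n + n) * ((4 * r%:R * vol r) ^+ 2 * bivol (4 * r)).
  apply: le_trans (le_trans h2 _); last by rewrite ler_wpM2l ?retp_ge0.
  have p0 : 0 <= r%:R * vol r by rewrite mulr_ge0 ?ltW.
  by rewrite ler_pXn2r// nnegrE// (le_trans p0).
rewrite -addnn -[leLHS]mul1r ler_pdivrMr ?mulr_gt0//.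
have rV : 0 < (r%:R * vol r) ^+ 2 by rewrite exprn_gt0// mulr_gt0.
rewrite -(ler_pM2l rV) mulr1; apply: le_trans h4 _.
rewrite le_eqVlt; apply/orP; left; apply/eqP; ring.
Qed.

End LazyWalk.

Arguments step {R}.
Arguments inner {R}.
Arguments dens {R}.
Arguments retp {R}.
Arguments vol {R}.
Arguments bivol {R}.


(** * Poissonisation *)

Section CauchyProduct.
Variable R : realType.
Implicit Types x y : nat -> R.

Lemma series_convE x y N :
  series (fun n => \sum_(k < n.+1) x k * y (n - k)%N) N =
  \sum_(0 <= k < N) x k * series y (N - k)%N.
Proof.
elim: N => [|N IH]; first by rewrite /series /= !big_nil.
rewrite seriesS IH [RHS]big_nat_recr//= subSnn [series y 1]/series /= big_nat1.
rewrite big_ord_recr/= subnn addrAC; congr (_ + _).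
rewrite -(big_mkord xpredT (fun k => x k * y (N - k)%N)) -big_split/=.
rewrite big_nat [RHS]big_nat; apply: eq_bigr => k kN.
by rewrite subSn ?(ltnW kN)// seriesS; ring.
Qed.

(** Mertens' theorem. Signs are prescribed for [x] only, since [y] will be the alternating
    exponential series at - 2 t. *)
Lemma cvg_series_conv x y (X Y : R) : (forall k, 0 <= x k) ->
  series x n @[n --> \oo] --> X -> series y n @[n --> \oo] --> Y ->
  series (fun n => \sum_(k < n.+1) x k * y (n - k)%N) n @[n --> \oo] --> X * Y.
Proof.
move=> x0 cX cY.
have XE : limn (series x) = X by apply/cvg_lim.
have cx : cvgn (series x) by apply/cvg_ex; exists X.
have leX n : series x n <= X.
  rewrite -XE; apply: nondecreasing_cvgn_le => //.
  by apply: nondecreasing_series => k _ _; exact: x0.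
have X0 : 0 <= X by apply: le_trans (leX 0); rewrite /series/= big_nil.
pose D m := series y m - Y.
have cD : D m @[m --> \oo] --> (0 : R).
  by rewrite -(subrr Y); apply: cvgB => //; exact: cvg_cst.
have [B B0 DB] : exists2 B, 0 < B & forall m, `|D m| <= B.
  have /cvg_seq_bounded/pinfty_ex_gt0[B B0 DB] : cvgn D by apply/cvg_ex; exists 0.
  by exists B => // m; exact: DB.
have -> : series (fun n => \sum_(k < n.+1) x k * y (n - k)%N) =
    (fun N => series x N * Y + \sum_(0 <= k < N) x k * D (N - k)%N).
  apply/funext => N; have -> : series x N = \sum_(0 <= k < N) x k by [].
  rewrite series_convE mulr_suml -big_split/=.
  by apply: eq_bigr => k _; rewrite /D; ring.
rewrite -[X * Y]addr0; apply: cvgD; first by apply: cvgMr_tmp.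
apply/cvgrPdist_le => e e0.
have e1 : 0 < e / 2 / (X + 1) by rewrite !divr_gt0// ltr_wpDl.
have e2 : 0 < e / 2 / B by rewrite !divr_gt0.
move/cvgrPdist_le/(_ _ e1) : cD => [M _ MD].
move/cvgrPdist_le/(_ _ e2) : cX => [N0 _ /(_ N0 (leqnn _)) NX].
exists (N0 + M)%N => // N /= NN; rewrite sub0r normrN.
(* For k below [N0] the remainder [D (N - k)] is small; from [N0] on, [D] is bounded by [B] and the
   tail of [x] is small. *)
rewrite (@big_cat_nat _ _ _ N0)//=; last by apply: leq_trans NN; exact: leq_addr.
apply: le_trans (ler_normD _ _) _; rewrite [leRHS]splitr; apply: lerD.
  apply: le_trans (ler_norm_sum _ _ _) _.
  apply: (@le_trans _ _ (\sum_(0 <= k < N0) x k * (e / 2 / (X + 1)))).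
    rewrite big_nat [leRHS]big_nat; apply: ler_sum => k kN.
    rewrite normrM (ger0_norm (x0 k)) ler_wpM2l//.
    by have := MD (N - k)%N; rewrite sub0r normrN; apply => /=; lia.
  rewrite -mulr_suml; apply: (le_trans (ler_wpM2r (ltW e1) (leX N0))).
  have X1 : 0 < X + 1 by rewrite ltr_wpDl.
  by rewrite mulrA ler_pdivrMr// mulrC ler_wpM2l ?lerDl// divr_ge0// ltW.
apply: le_trans (ler_norm_sum _ _ _) _.
apply: (@le_trans _ _ (\sum_(N0 <= k < N) x k * B)).
  by apply: ler_sum => k _; rewrite normrM (ger0_norm (x0 k)) ler_wpM2l.
rewrite -mulr_suml -ler_pdivlMr//.
have -> : \sum_(N0 <= k < N) x k = series x N - series x N0.
  by rewrite sub_series_geq//; lia.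
by have := leX N; have := le_trans (ler_norm _) NX; lra.
Qed.

End CauchyProduct.

Section Poissonization.
Variables (R : realType) (tau : int -> R).
Hypothesis tau_ge1 : forall x, 1 <= tau x.

Let tau_gt0 x : 0 < tau x. Proof. exact: lt_le_trans (tau_ge1 x). Qed.
Let tau_neq0 x : tau x != 0. Proof. by rewrite gt_eqF. Qed.

Lemma bouchaud_gen_step f x : bouchaud_gen tau f x = 2 * (step tau f x - f x).
Proof. by rewrite /bouchaud_gen /step /lap; field; rewrite tau_neq0. Qed.

Lemma bouchaud_gen_sum n (c : nat -> R) (g : nat -> int -> R) x :
  bouchaud_gen tau (fun z => \sum_(k < n) c k * g k z) x =
  \sum_(k < n) c k * bouchaud_gen tau (g k) x.
Proof.
rewrite /bouchaud_gen -!sumrB -big_split/= mulr_sumr.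
by apply: eq_bigr => k _; ring.
Qed.

(** Binomial theorem for (2 (Q - 1))^n, by Pascal's rule. *)
Lemma iter_bouchaud_gen n f x : iter n (bouchaud_gen tau) f x =
  \sum_(k < n.+1) (2 ^+ n * (- 1) ^+ (n - k)%N * ('C(n, k))%:R) * iter k (step tau) f x.
Proof.
elim: n x => [|n IH] x; first by rewrite big_ord_recl big_ord0/= bin0; ring.
rewrite iterS.
have -> : iter n (bouchaud_gen tau) f = fun z => \sum_(k < n.+1)
    (2 ^+ n * (- 1) ^+ (n - k)%N * ('C(n, k))%:R) * iter k (step tau) f z.
  by apply/funext => z; exact: IH.
rewrite (bouchaud_gen_sum n.+1 (fun k => 2 ^+ n * (- 1) ^+ (n - k)%N * ('C(n, k))%:R)
   (fun k => iter k (step tau) f)).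
under eq_bigr do rewrite bouchaud_gen_step -iterS.
set g := fun k => iter k (step tau) f x.
transitivity (\sum_(k < n.+1) 2 ^+ n.+1 * (- 1) ^+ (n - k)%N * 'C(n, k)%:R * g k.+1 +
   \sum_(k < n.+1) 2 ^+ n.+1 * (- 1) ^+ (n.+1 - k)%N * 'C(n, k)%:R * g k).
  rewrite -big_split/=; apply: eq_bigr => k _.
  by rewrite subSn -1?ltnS// !exprS /g iterS; ring.
rewrite [X in _ + X = _]big_ord_recl [RHS]big_ord_recl !bin0 addrCA; congr (_ + _).
rewrite [\sum_(i < n) _](_ : _ = \sum_(k < n.+1) 2 ^+ n.+1 * (- 1) ^+ (n - k)%N * 'C(n, k.+1)%:R * g k.+1); last first.
  rewrite [RHS]big_ord_recr/= bin_small// mulr0 mul0r addr0.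
  by apply: eq_bigr => k _; rewrite /bump/= add1n subSS.
rewrite -big_split/=; apply: eq_bigr => k _.
by rewrite /bump/= !add1n subSS binS natrD /g add0n iterS; ring.
Qed.

Let a := retp tau.

Lemma iter_step_scale k f c x :
  iter k (step tau) (fun z => f z * c) x = iter k (step tau) f x * c.
Proof. by elim: k x => [|k IH] x //=; rewrite /step /lap !IH; ring. Qed.

Lemma iter_bouchaud_gen_retp n :
  iter n (bouchaud_gen tau) (site_ind 0) 0 / tau 0 =
  \sum_(k < n.+1) (2 ^+ n * (- 1) ^+ (n - k)%N * ('C(n, k))%:R) * a k.
Proof.
rewrite iter_bouchaud_gen mulr_suml; apply: eq_bigr => k _; rewrite -[LHS]mulrA; congr (_ * _).
rewrite -iter_step_scale /a /retp /dens; congr (iter _ _ _ _).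
by apply/funext => z; rewrite /site_ind; case: ifP => _; rewrite ?mul1r ?mul0r.
Qed.

(** Up to the factor expR (- s), the mean of [a] at a Poisson time of parameter [s]. *)
Definition poisson_sum s := limn (series (fun k => exp_coeff s k * a k)).

Lemma exp_coeff_retp_ge0 s k : 0 <= s -> 0 <= exp_coeff s k * a k.
Proof. by move=> s0; rewrite mulr_ge0 ?retp_ge0// /exp_coeff/= divr_ge0// exprn_ge0. Qed.

Lemma cvg_poisson_sum s : 0 <= s -> cvgn (series (fun k => exp_coeff s k * a k)).
Proof.
move=> s0; apply: (@series_le_cvg _ _ (exp_coeff s)); last exact: is_cvg_series_exp_coeff.
- by move=> k; exact: exp_coeff_retp_ge0.
- by move=> k; rewrite /exp_coeff/= divr_ge0// exprn_ge0.
- move=> k; rewrite ler_piMr ?retp_le1//.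
  by rewrite /exp_coeff/= divr_ge0// exprn_ge0.
Qed.

(** As C(n,k) / n! = 1 / (k! (n - k)!), the Cauchy product of [poisson_sum] and the series of expR
    (- 2 t) is the defining series of the semigroup, term by term. *)
Lemma heat_kernelE t : 0 <= t ->
  heat_kernel tau t 0 0 = expR (- (2 * t)) * poisson_sum (2 * t).
Proof.
move=> t0; have s0 : 0 <= 2 * t by rewrite mulr_ge0.
have h := @cvg_series_conv _ _ _ _ _ (fun k => exp_coeff_retp_ge0 _ k s0) (cvg_poisson_sum _ s0)
  (is_cvg_series_exp_coeff (- (2 * t))).
rewrite /heat_kernel /bouchaud_trans.
set F := fun N => _.
suff -> : limn F = poisson_sum (2 * t) * expR (- (2 * t)) * tau 0 by rewrite mulfK// mulrC.
apply/cvg_lim => //.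
have -> : F = (fun N => series (fun n => \sum_(k < n.+1)
    (exp_coeff (2 * t) k * a k) * exp_coeff (- (2 * t)) (n - k)%N) N * tau 0).
  apply/funext => N; rewrite /F /series/= mulr_suml; apply: eq_bigr => n _.
  rewrite -[iter n _ _ _](mulfVK (tau_neq0 0)) iter_bouchaud_gen_retp mulrA; congr (_ * _).
  rewrite mulr_sumr; apply: eq_bigr => k _.
  have kn : (k <= n)%N by rewrite -ltnS.
  rewrite /exp_coeff/= -(bin_fact kn) !natrM [(- (2 * t)) ^+ _]exprNn.
  rewrite !exprMn -[in t ^+ n](subnKC kn) -[in 2 ^+ n](subnKC kn) !exprD.
  have fn0 m : m`!%:R != 0 :> R by rewrite pnatr_eq0 -lt0n fact_gt0.
  by field; rewrite !fn0 pnatr_eq0 -lt0n bin_gt0 kn.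
by apply: cvgMr_tmp; exact: h.
Qed.

Lemma heat_kernel_ge0 t : 0 <= t -> 0 <= heat_kernel tau t 0 0.
Proof.
move=> t0; have s0 : 0 <= 2 * t by rewrite mulr_ge0.
rewrite heat_kernelE// mulr_ge0 ?expR_ge0//.
apply: limr_ge; first exact: cvg_poisson_sum.
by apply: nearW => N; apply: sumr_ge0 => k _; exact: exp_coeff_retp_ge0.
Qed.

(** Truncated form of the fact that a Poisson variable of parameter [s] has mean [s]. *)
Lemma sum_natr_exp_coeff_le (s : R) N : 0 <= s ->
  \sum_(0 <= k < N) k%:R * exp_coeff s k <= s * series (exp_coeff s) N.
Proof.
move=> s0; have e0 k : 0 <= exp_coeff s k by rewrite /exp_coeff/= divr_ge0// exprn_ge0.
case: N => [|N]; first by rewrite /series/= !big_nil mulr0.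
rewrite big_nat_recl// mul0r add0r seriesS mulrDr.
apply: (@le_trans _ _ (s * series (exp_coeff s) N)); last first.
  by rewrite lerDr mulr_ge0.
rewrite /series/= mulr_sumr; apply: ler_sum => k _.
rewrite le_eqVlt; apply/orP; left; apply/eqP.
rewrite /exp_coeff/= factS natrM exprS; field.
have F0 : k`!%:R != 0 :> R by rewrite pnatr_eq0 -lt0n fact_gt0.
by rewrite F0 addrC natr1 pnatr_eq0.
Qed.

(** Markov's inequality in the pointwise form a_k >= a_n (1 - k / n), valid for all k by
    monotonicity. The Poisson time has mean 2 t <= n / 2, so 1 - k / n has mean at least 1 / 2. *)
Lemma heat_kernel_lower t n : 0 < t -> 4 * t <= n%:R ->
  a n <= 2 * heat_kernel tau t 0 0.
Proof.
move=> t0 tn; set s : R := 2 * t; have s0 : 0 < s by rewrite /s; lra.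
have n0 : 0 < n%:R :> R by lra.
rewrite heat_kernelE ?(ltW t0)// -/s mulrCA expRN mulrC ler_pdivlMr ?expR_gt0//.
suff : a n * (expR s / 2) <= poisson_sum s by lra.
apply: (@ler_cvg_to _ \oo _ R (fun N => a n * (series (exp_coeff s) N / 2))
   (series (fun k => exp_coeff s k * a k))).
- by apply: cvgMl_tmp; apply: cvgMr_tmp; exact: is_cvg_series_exp_coeff.
- by apply: cvg_poisson_sum; exact: ltW.
apply: nearW => N.
have e0 k : 0 <= exp_coeff s k by rewrite /exp_coeff/= divr_ge0// exprn_ge0// ltW.
have h1 := sum_natr_exp_coeff_le s N (ltW s0).
have E0 : 0 <= series (exp_coeff s) N by apply: sumr_ge0.
apply: (@le_trans _ _ (\sum_(0 <= k < N) exp_coeff s k * (a n * (1 - k%:R / n%:R)))).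
  have -> : \sum_(0 <= k < N) exp_coeff s k * (a n * (1 - k%:R / n%:R)) =
     a n * (series (exp_coeff s) N - (\sum_(0 <= k < N) k%:R * exp_coeff s k) / n%:R).
    rewrite mulrBr mulr_suml !mulr_sumr -sumrB; apply: eq_bigr => k _; ring.
  rewrite ler_wpM2l ?retp_ge0// lerBrDr -lerBrDl.
  have -> : series (exp_coeff s) N - series (exp_coeff s) N / 2 = series (exp_coeff s) N / 2 by field.
  rewrite ler_pdivrMr//; apply: le_trans h1 _.
  have sn : 0 <= n%:R / 2 - s by rewrite /s; lra.
  by have := mulr_ge0 E0 sn; lra.
apply: ler_sum => k _; rewrite ler_wpM2l//.
have [kn|nk] := leqP k n.
  apply: (@le_trans _ _ (a n)); last exact: retp_noninc.
  by rewrite ler_piMr ?retp_ge0// gerBl divr_ge0.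
apply: (@le_trans _ _ 0); last exact: retp_ge0.
rewrite mulr_ge0_le0 ?retp_ge0// subr_le0 ler_pdivlMr// mul1r ler_nat; exact: ltnW.
Qed.

(** Terms with k >= n are at most a_n. For k < n, a_k <= 1 <= 2^(n - k), and the weights 2^(-k) turn
    the exponential series at s = 2 t into expR t, so the error is at most 2^n expR (- t). *)
Lemma heat_kernel_upper t n : 0 < t -> n%:R <= t / 2 ->
  heat_kernel tau t 0 0 <= a n + expR (- (t / 2)).
Proof.
move=> t0 nt; set s : R := 2 * t; have s0 : 0 < s by rewrite /s; lra.
rewrite heat_kernelE ?(ltW t0)// -/s expRN mulrC ler_pdivrMr ?expR_gt0//.
apply: (@le_trans _ _ (a n * expR s + 2 ^+ n * expR (s / 2))).
  apply: (@ler_cvg_to _ \oo _ R (series (fun k => exp_coeff s k * a k))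
    (fun N => a n * series (exp_coeff s) N + 2 ^+ n * series (exp_coeff (s / 2)) N)).
  - by apply: cvg_poisson_sum; exact: ltW.
  - by apply: cvgD; apply: cvgMl_tmp; exact: is_cvg_series_exp_coeff.
  apply: nearW => N; rewrite /series/= !mulr_sumr -big_split/=; apply: ler_sum => k _.
  have -> : exp_coeff (s / 2) k = exp_coeff s k * 2^-1 ^+ k.
    by rewrite /exp_coeff/= exprMn; ring.
  have e0 : 0 <= exp_coeff s k by rewrite /exp_coeff/= divr_ge0// exprn_ge0// ltW.
  rewrite [a n * _]mulrC mulrCA -mulrDr ler_wpM2l//.
  have p0 : 0 <= 2 ^+ n * 2^-1 ^+ k :> R by rewrite mulr_ge0// exprn_ge0// invr_ge0.
  have [nk|kn] := leqP n k.
    by apply: le_trans (retp_noninc _ _ _ _ _ nk) _ => //; rewrite lerDl.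
  apply: le_trans (retp_le1 _ _ _ _) _ => //.
  rewrite ler_wpDl ?retp_ge0// exprVn ler_pdivlMr ?exprn_gt0// mul1r.
  by rewrite ler_eXn2l ?ltr1n// ltnW.
rewrite mulrDl lerD2l -expRD.
have -> : - (t / 2) + s = t / 2 + s / 2 by rewrite /s; field.
rewrite expRD ler_wpM2r ?expR_ge0//.
apply: (@le_trans _ _ (expR n%:R)); last by rewrite ler_expR.
rewrite -[n%:R]mulr1 expRM_natl; apply: lerXn2r; rewrite ?nnegrE ?expR_ge0//.
by have := expR_ge1Dx (1 : R); lra.
Qed.

Lemma heat_kernel_le_vol t r : 8 <= t -> (0 < r)%N ->
  heat_kernel tau t 0 0 <= 2 / vol tau r + 130 * r%:R / t.
Proof.
move=> t8 r0; have rR : 1 <= r%:R :> R by rewrite ler1n.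
have t0 : 0 < t by lra.
(* This keeps 2 k <= t / 2, and [8 <= t] gives t / 8 <= k, whence 16 r / k <= 128 r / t. The
   remaining 2 r / t of the constant 130 covers expR (- (t / 2)). *)
set k := Num.truncn (t / 4).
have /andP[k1 k2] : k%:R <= t / 4 < k.+1%:R by apply: truncn_itv; lra.
have k3 : t / 8 <= k%:R by have := natr1 k : k%:R + 1 = k.+1%:R :> R; lra.
have k0 : (0 < k)%N by rewrite -(ltr_nat R); lra.
have kR : 0 < k%:R :> R by rewrite ltr0n.
have h1 := heat_kernel_upper t k.*2 t0.
have {h1} := h1 ltac:(rewrite -mul2n natrM; lra).
have := retp_upper _ _ tau_ge1 r k r0 k0; rewrite -/a => h2 h3.
apply: le_trans h3 _.
have h4 : expR (- (t / 2)) <= 2 * r%:R / t.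
  rewrite expRN -[leLHS]mul1r ler_pdivrMr ?expR_gt0// mulrAC ler_pdivlMr// mul1r.
  have := expR_ge1Dx (t / 2); nra.
have h5 : 16 * r%:R / k%:R <= 128 * r%:R / t.
  rewrite ler_pdivrMr// mulrAC ler_pdivlMr//; nra.
have -> : 130 * r%:R / t = 2 * r%:R / t + 128 * r%:R / t by field; rewrite gt_eqF.
lra.
Qed.

Lemma heat_kernel_ge_vol t r : 0 < t -> (0 < r)%N -> 2 * t + 1 <= r%:R * vol tau r ->
  (32 * bivol tau (4 * r))^-1 <= heat_kernel tau t 0 0.
Proof.
move=> t0 r0 tr.
have W0 : 0 < bivol tau (4 * r) by apply: bivol_gt0 => //; lia.
(* Rounding 2 t up ensures 4 t <= 2 n; the [+ 1] in the hypothesis pays for it. *)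
set n := (Num.truncn (2 * t)).+1.
have /andP[n1 n2] : (Num.truncn (2 * t))%:R <= 2 * t < n%:R by apply: truncn_itv; lra.
have n3 : n%:R <= 2 * t + 1 by have := natr1 (Num.truncn (2 * t)) : _ + 1 = n%:R :> R; lra.
have h1 := retp_lower _ _ tau_ge1 r n r0 (le_trans n3 tr).
have h2 := heat_kernel_lower t n.*2 t0.
have {}h2 := h2 ltac:(rewrite -mul2n natrM; lra).
have : (16 * bivol tau (4 * r))^-1 <= 2 * heat_kernel tau t 0 0 by exact: le_trans h1 h2.
have -> : (16 * bivol tau (4 * r))^-1 = 2 * (32 * bivol tau (4 * r))^-1.
  by field; rewrite gt_eqF.
by rewrite ler_pM2l.
Qed.

End Poissonization.


(** * Independence and exponential Markov inequalities *)

Section Independence.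
Context d (Omega : measurableType d) (R : realType) (P : probability Omega R).
Variable tau : int -> Omega -> R.
Hypothesis mtau : forall x, measurable_fun setT (tau x).
Hypothesis itau : mutually_independent_rvs P tau.

Definition rect (s : seq int) (B : int -> set R) : set Omega :=
  \big[setI/setT]_(i <- s) (tau i @^-1` B i).

Lemma measurable_rect s B : (forall i, measurable (B i)) -> measurable (rect s B).
Proof.
move=> mB; apply: bigsetI_measurable => i _.
by rewrite -[_ @^-1` _]setTI; exact: mtau.
Qed.

Lemma eq_rect_in s B B' : {in s, forall i, B i = B' i} -> rect s B = rect s B'.
Proof. by move=> BB'; apply: eq_big_seq => i /BB' ->. Qed.

Lemma rect_cat s1 s2 B : rect (s1 ++ s2) B = rect s1 B `&` rect s2 B.
Proof. exact: big_cat. Qed.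

Lemma rectP s B w : rect s B w <-> {in s, forall i, B i (tau i w)}.
Proof.
rewrite /rect; elim: s => [|i s IH]; first by rewrite big_nil; split.
rewrite big_cons; split => [[Bi /IH Bs] j|Bs].
  by rewrite inE => /predU1P[->//|/Bs].
split; first by apply: Bs; rewrite mem_head.
by apply/IH => j js; apply: Bs; rewrite inE js orbT.
Qed.

Lemma rect_cons x s (D : set R) B : x \notin s ->
  rect (x :: s) (fun i => if i == x then D else B i) =
  tau x @^-1` D `&` rect s B.
Proof.
move=> xs; rewrite /rect big_cons eqxx; congr (_ `&` _).
by apply: eq_big_seq => i /=; case: eqP => // -> ix; rewrite ix in xs.
Qed.

Lemma rect_disjoint_cat s1 s2 B1 B2 : uniq (s1 ++ s2) ->
  rect s1 B1 `&` rect s2 B2 =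
  rect (s1 ++ s2) (fun i => if i \in s1 then B1 i else B2 i).
Proof.
rewrite cat_uniq => /and3P[_ /hasPn h _]; rewrite rect_cat; congr (_ `&` _).
  by apply: eq_rect_in => i ->.
by apply: eq_rect_in => i /h /= /negbTE ->.
Qed.

Lemma prob_rect s B : uniq s -> (forall i, measurable (B i)) ->
  P (rect s B) = (\prod_(i <- s) P (tau i @^-1` B i))%E.
Proof. by move=> us mB; exact: itau. Qed.

Lemma prob_rect_disjoint s1 s2 B1 B2 : uniq (s1 ++ s2) ->
  (forall i, measurable (B1 i)) -> (forall i, measurable (B2 i)) ->
  P (rect s1 B1 `&` rect s2 B2) = (P (rect s1 B1) * P (rect s2 B2))%E.
Proof.
move=> us m1 m2; rewrite rect_disjoint_cat// prob_rect//; last by move=> i; case: ifP.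
rewrite big_cat/=; move: us; rewrite cat_uniq => /and3P[u1 /hasPn h u2].
rewrite !prob_rect//; congr (_ * _)%E; apply: eq_big_seq => i /=; first by move=> ->.
by move=> /h /= /negbTE ->.
Qed.

(* Independence is only known for rectangles, so products are integrated for
   finite combinations of indicators; the extra rectangle makes the induction
   on [s] go through. *)
Section SimpleProduct.
Variables (J : nat) (c q : nat -> R) (D : nat -> set R).
Hypothesis c0 : forall j, 0 <= c j.
Hypothesis mD : forall j, measurable (D j).
Hypothesis qD : forall i j, P (tau i @^-1` D j) = (q j)%:E.

Definition simplef (u : R) : R := \sum_(j < J) c j * \1_(D j) u.

Lemma simplef_ge0 u : 0 <= simplef u.
Proof. by apply: sumr_ge0 => j _; rewrite mulr_ge0. Qed.

Lemma measurable_simplef : measurable_fun setT simplef.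
Proof.
apply: measurable_sum => j; apply: measurable_funM.
  exact: measurable_cst.
exact: measurable_indic.
Qed.

Lemma measurable_prod_simplef s :
  measurable_fun setT (fun w => \prod_(i <- s) simplef (tau i w)).
Proof.
apply: measurable_prod => i _; apply: measurableT_comp => //.
exact: measurable_simplef.
Qed.

Lemma integral_prod_simplef_rect s s' B : uniq (s ++ s') ->
  (forall i, measurable (B i)) ->
  (\int[P]_w ((\prod_(i <- s) simplef (tau i w)) * \1_(rect s' B) w)%:E =
   ((\sum_(j < J) c j * q j) ^+ size s)%:E * P (rect s' B))%E.
Proof.
elim: s s' B => [|x s IH] s' B /= us mB.
  rewrite expr0 mul1e; under eq_integral do rewrite big_nil mul1r.
  by rewrite integral_indic ?setIT//; exact: measurable_rect.
move: us; rewrite mem_cat negb_or => /andP[/andP[xs xs'] us].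
pose B' j i := if i == x then D j else B i.
have mB' j i : measurable (B' j i) by rewrite /B'; case: ifP.
have us' : uniq (s ++ x :: s').
  by rewrite -cat1s uniq_catCA cat1s /= mem_cat negb_or xs xs'.
(* Expand the factor at [x] and move each of its indicators into the rectangle, to which the
   induction hypothesis applies. *)
transitivity (\int[P]_w \sum_(j < J) ((c j)%:E *
   ((\prod_(i <- s) simplef (tau i w)) * \1_(rect (x :: s') (B' j)) w)%:E))%E.
  apply: eq_integral => w _.
  under [RHS]eq_bigr do rewrite -EFinM; rewrite sumEFin; congr EFin.
  rewrite big_cons {1}/simplef !mulr_suml; apply: eq_bigr => j _.
  rewrite rect_cons// indicI /=.
  have -> : \1_(tau x @^-1` D j) w = \1_(D j) (tau x w) :> R by rewrite !indicE.
  by ring.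
have mf s1 s2 B2 : (forall i, measurable (B2 i)) -> measurable_fun setT
    (EFin \o (fun w => (\prod_(i <- s1) simplef (tau i w)) * \1_(rect s2 B2) w)).
  move=> mB2; apply/measurable_EFinP; apply: measurable_funM.
    exact: measurable_prod_simplef.
  by apply: measurable_indic; exact: measurable_rect.
have f0 s1 s2 B2 w : (0 <= ((\prod_(i <- s1) simplef (tau i w)) * \1_(rect s2 B2) w)%:E)%E.
  by rewrite lee_fin mulr_ge0// prodr_ge0// => i _; exact: simplef_ge0.
rewrite ge0_integral_sum//; last 2 first.
- move=> j; apply: measurable_funeM; exact: mf.
- by move=> j w _; apply: mule_ge0; [rewrite lee_fin | exact: f0].
transitivity (\sum_(j < J) (c j)%:E * (((\sum_(j < J) c j * q j) ^+ size s)%:E *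
    ((q j)%:E * P (rect s' B))))%E.
  apply: eq_bigr => j _; rewrite ge0_integralZl ?lee_fin//; last exact: mf.
  rewrite IH//; congr (_ * (_ * _))%E.
  rewrite rect_cons// -(qD x).
  have -> : tau x @^-1` D j = rect [:: x] (fun=> D j) by rewrite /rect big_seq1.
  by rewrite prob_rect_disjoint//= xs'; move: us; rewrite cat_uniq => /and3P[].
have -> : P (rect s' B) = (fine (P (rect s' B)))%:E.
  by rewrite fineK// fin_num_measure//; exact: measurable_rect.
under [LHS]eq_bigr do rewrite -!EFinM; rewrite sumEFin -EFinM; congr EFin.
rewrite exprS !mulr_suml; apply: eq_bigr => j _; ring.
Qed.

Lemma markov_prod_simplef s a : uniq s ->
  measurable [set w | expR a <= \prod_(i <- s) simplef (tau i w)] /\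
  (P [set w | (expR a <= \prod_(i <- s) simplef (tau i w))%R] <=
   (expR (- a) * (\sum_(j < J) c j * q j) ^+ size s)%:E)%E.
Proof.
move=> us; set A := [set w | _].
have mA : measurable A.
  have := measurable_prod_simplef s => /(_ measurableT [set` `[expR a, +oo[] (measurable_itv _)).
  by rewrite setTI; congr measurable; apply/seteqP; split => w /=; rewrite in_itv/= andbT.
split => //.
have := integral_prod_simplef_rect s [::] (fun=> setT); rewrite cats0 => /(_ us (fun=> measurableT)).
rewrite /rect big_nil probability_setT mule1 => h.
have key : ((expR a)%:E * P A <= ((\sum_(j < J) c j * q j) ^+ size s)%:E)%E.
  rewrite -h -[X in (_ * P X)%E]setIT -integral_indic// -ge0_integralZl//; last first.
    exact/measurable_EFinP/measurable_indic.
  apply: ge0_le_integral => //.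
  - apply: measurable_funeM; exact/measurable_EFinP/measurable_indic.
  - apply/measurable_EFinP; apply: measurable_funM.
      exact: measurable_prod_simplef.
    exact: measurable_indic.
  move=> w _; rewrite -EFinM lee_fin indicT mulr1 indicE.
  have [wA|wA] := boolP (w \in A); first by rewrite mulr1; move: wA; rewrite inE.
  by rewrite mulr0 prodr_ge0// => i _; exact: simplef_ge0.
move: key; rewrite -[P A]fineK ?fin_num_measure// -EFinM !lee_fin => key.
by rewrite expRN ler_pdivlMl ?expR_gt0.
Qed.

End SimpleProduct.
End Independence.

Arguments rect {d Omega R}.
Arguments simplef {R}.


(** * Exponential tail bounds for sums of Pareto variables *)

Section Tails.
Context d (Omega : measurableType d) (R : realType) (P : probability Omega R).
Variables (tau : int -> Omega -> R) (alpha : R).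
Hypothesis alpha0 : 0 < alpha.
Hypothesis mtau : forall x, measurable_fun setT (tau x).
Hypothesis itau : mutually_independent_rvs P tau.
Hypothesis tail : forall x (u : R), 1 <= u ->
  P [set w | u < tau x w] = (u `^ (- alpha))%:E.

Definition ptail (u : R) : R := if 1 <= u then u `^ (- alpha) else 1.

Lemma measurable_tau_itv i (I : interval R) : measurable (tau i @^-1` [set` I]).
Proof. by rewrite -[_ @^-1` _]setTI; apply: mtau => //; exact: measurable_itv. Qed.

Lemma prob_gt1 i : P [set w | 1 < tau i w] = 1%E.
Proof. by rewrite tail// powR1. Qed.

Lemma tau_itvoyE i u : tau i @^-1` [set` `]u, +oo[] = [set w | u < tau i w].
Proof. by apply/seteqP; split => w /=; rewrite in_itv/= andbT. Qed.

Lemma prob_tau_gt i u : P (tau i @^-1` [set` `]u, +oo[]) = (ptail u)%:E.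
Proof.
rewrite tau_itvoyE /ptail; case: ifP => u1; first exact: tail.
apply/eqP; rewrite eq_le probability_le1/=; last first.
  by rewrite -tau_itvoyE; exact: measurable_tau_itv.
rewrite -(prob_gt1 i); apply: le_measure; rewrite ?inE -?tau_itvoyE; try exact: measurable_tau_itv.
move=> w; rewrite !tau_itvoyE /=; apply: le_lt_trans.
by move: u1; case: leP => // /ltW.
Qed.

Lemma prob_tau_le i u : P (tau i @^-1` [set` `]-oo, u]]) = (1 - ptail u)%:E.
Proof.
have -> : tau i @^-1` [set` `]-oo, u]] = ~` (tau i @^-1` [set` `]u, +oo[]).
  by apply/seteqP; split => w /=; rewrite !in_itv/= andbT leNgt => /negP.
by rewrite probability_setC ?prob_tau_gt//; exact: measurable_tau_itv.
Qed.

Lemma ptail_le1 u : ptail u <= 1.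
Proof.
rewrite /ptail; case: ifP => // u1.
by rewrite -(powRr0 u) ler_powR// oppr_le0 ltW.
Qed.

Lemma ptail_ge0 u : 0 <= ptail u.
Proof. by rewrite /ptail; case: ifP => // _; exact: powR_ge0. Qed.

Lemma ptail_le u : 0 < u -> ptail u <= u `^ (- alpha).
Proof.
rewrite /ptail => u0; case: ifPn => //; rewrite -ltNge => /ltW u1.
rewrite powRN -[1]invr1 lef_pV2 ?posrE ?powR_gt0//.
apply: (@le_trans _ _ (1 `^ alpha)); last by rewrite powR1.
by rewrite ge0_ler_powR// ?nnegrE ltW.
Qed.

Lemma ae_gt1 : {ae P, forall w, forall x, 1 < tau x w}.
Proof.
have h (x : int) : {ae P, forall w, 1 < tau x w}.
  exists (~` [set w | 1 < tau x w]); split => //.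
    by apply: measurableC; rewrite -tau_itvoyE; exact: measurable_tau_itv.
  rewrite probability_setC ?prob_gt1 ?subee//.
  by rewrite -tau_itvoyE; exact: measurable_tau_itv.
have := @ae_foralln _ _ _ P (fun n w => 1 < tau n%:Z w /\ 1 < tau (- n%:Z) w).
have H : forall n : nat, \forall w \ae P, 1 < tau n%:Z w /\ 1 < tau (- n%:Z) w.
  by move=> n; apply: filterI; exact: h.
move=> /(_ H); apply: filterS => w hw x.
case: (intP x) => [|n|n]; [by have [] := hw 0%N|by have [] := hw n.+1|by have [] := hw n.+1].
Qed.

Lemma sum_lower_tail s (L k : R) : uniq s -> 1 <= L ->
  exists A, [/\ measurable A,
    (P A <= (expR (k - (size s)%:R * L `^ (- alpha) / 2))%:E)%E &
    forall w, ~ A w -> (forall x, 0 <= tau x w) -> L * k <= \sum_(i <- s) tau i w].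
Proof.
move=> us L1.
pose c (j : nat) : R := if j == 0 then 1 else expR (- 1).
pose D (j : nat) : set R := if j == 0 then [set` `]-oo, L]] else [set` `]L, +oo[].
pose q (j : nat) : R := if j == 0 then 1 - ptail L else ptail L.
have c0 j : 0 <= c j by rewrite /c; case: ifP => // _; exact: expR_ge0.
have mD j : measurable (D j) by rewrite /D; case: ifP.
have qD i j : P (tau i @^-1` D j) = (q j)%:E.
  by rewrite /D /q; case: ifP => _; [exact: prob_tau_le | exact: prob_tau_gt].
have [mA PA] := markov_prod_simplef _ _ _ _ _ mtau itau 2 _ _ _ c0 mD qD s (- k) us.
eexists; split; [exact: mA| |].
  apply: le_trans PA _; rewrite lee_fin opprK !big_ord_recl big_ord0 /c /q /= !mul1r addr0.
  have -> : ptail L = L `^ (- alpha) by rewrite /ptail L1.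
  set p := L `^ (- alpha).
  rewrite expRD ler_wpM2l ?expR_ge0//.
  have -> : - ((size s)%:R * p / 2) = (size s)%:R * (- (p / 2)) by ring.
  rewrite expRM_natl; apply: lerXn2r; rewrite ?nnegrE ?expR_ge0//.
    have p1 : p <= 1 by have := ptail_le1 L; rewrite /ptail L1.
    by rewrite addr_ge0 ?subr_ge0// mulr_ge0 ?expR_ge0 ?powR_ge0.
  apply: le_trans (expR_ge1Dx _).
  have h : expR (- 1) <= 2^-1 :> R.
    by rewrite expRN lef_pV2 ?posrE ?expR_gt0//; have := expR_ge1Dx (1 : R); lra.
  have := ler_wpM2r (powR_ge0 L (- alpha)) h; rewrite -/p; lra.
move=> w /= /negP; rewrite -ltNge => hw t0.
have E u : simplef 2 c D u = expR (- (L < u)%R%:R).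
  rewrite /simplef !big_ord_recl big_ord0 /c /D /= addr0 !indicE.
  rewrite !mem_setE !in_itv/= andbT mul1r; case: ltP => _ /=.
    by rewrite add0r mulr1.
  by rewrite mulr0 addr0 oppr0 expR0.
move: hw; under eq_bigr do rewrite E.
rewrite -expR_sum ltr_expR sumrN ltrN2 => hk.
apply: (@le_trans _ _ (L * \sum_(i <- s) (L < tau i w)%R%:R)).
  by rewrite ler_wpM2l ?(ltW hk)// (le_trans _ L1).
rewrite mulr_sumr; apply: ler_sum => i _.
by case: ltP => h; rewrite ?mulr1 ?mulr0// ltW.
Qed.

(** For the least j with L / 2^(j+1) < u, the minimum is at most 2^(-j), so that this one term is
    enough. *)
Lemma min_le_dyadic (L u : R) J : 0 < L -> L / 2 ^+ J.+1 < u ->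
  Num.min (u / L) 1 <= \sum_(j < J.+1) (2 ^- j) * (L / 2 ^+ j.+1 < u)%R%:R.
Proof.
move=> L0; elim: J => [|J IH] hu.
  by rewrite big_ord_recl big_ord0 /= hu expr0 invr1 mul1r addr0 ge_min lexx orbT.
rewrite big_ord_recr /=; case: (ltP (L / 2 ^+ J.+1) u) => [/IH h|h].
  by apply: le_trans h _; rewrite lerDl mulr_ge0// invr_ge0 exprn_ge0.
rewrite hu mulr1 -[leLHS]add0r; apply: lerD.
  by apply: sumr_ge0 => j _; rewrite mulr_ge0// invr_ge0 exprn_ge0.
by rewrite ge_min ler_pdivrMr// mulrC h.
Qed.

Hypothesis alpha1 : alpha < 1.

(* The values [2^-j] at the levels [L / 2^j] dominate [min (tau / L) 1]; the
   constant is the sum of the geometric series of their tail probabilities. *)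
Definition upper_const : R := 2 / (1 - 2 `^ (alpha - 1)).

Lemma upper_const_ge0 : 0 <= upper_const.
Proof.
rewrite /upper_const divr_ge0// subr_ge0 -[leRHS](powRr0 2) ler_powR ?ler1n//.
by rewrite subr_le0 ltW.
Qed.

(** Exponential Markov inequality for half the truncated sum, which explains the 2 in [2 * a]: with
    y = min(tau / L, 1), expR (y / 2) <= 1 + y, and the dyadic domination of y makes the mean at
    most 1 + [upper_const] L^(-alpha). *)
Lemma sum_upper_tail s (L a : R) : uniq s -> 0 < L ->
  exists A, [/\ measurable A,
    (P A <= (expR (- a + upper_const * (size s)%:R * L `^ (- alpha)))%:E)%E &
    forall w, ~ A w -> (forall x, 1 < tau x w) ->
      \sum_(i <- s) Num.min (tau i w / L) 1 <= 2 * a].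
Proof.
move=> us L0.
(* Since tau > 1, levels down to 1 are enough, and the dominating function stays simple. *)
have [J LJ] : exists J, L / 2 ^+ J.+1 <= 1.
  exists (Num.truncn L); rewrite ler_pdivrMr ?exprn_gt0// mul1r.
  have /andP[_ /ltW h] := truncn_itv (ltW L0); apply: le_trans h _.
  by rewrite -natrX ler_nat ltnW// ltn_expl.
pose c (j : nat) : R := if j == 0 then 1 else 2 / 2 ^+ j.
pose D (j : nat) : set R := if j == 0 then setT else [set` `]L / 2 ^+ j, +oo[].
pose q (j : nat) : R := if j == 0 then 1 else ptail (L / 2 ^+ j).
have c0 j : 0 <= c j by rewrite /c; case: ifP => // _; rewrite divr_ge0// exprn_ge0.
have mD j : measurable (D j) by rewrite /D; case: ifP.
have qD i j : P (tau i @^-1` D j) = (q j)%:E.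
  rewrite /D /q; case: ifP => _; last exact: prob_tau_gt.
  by rewrite preimage_setT probability_setT.
have [mA PA] := markov_prod_simplef _ _ _ _ _ mtau itau J.+2 _ _ _ c0 mD qD s a us.
eexists; split; [exact: mA| |].
  apply: le_trans PA _; rewrite lee_fin expRD ler_wpM2l ?expR_ge0//.
  have -> : upper_const * (size s)%:R * L `^ (- alpha) = (size s)%:R * (upper_const * L `^ (- alpha)) by ring.
  rewrite expRM_natl; apply: lerXn2r; rewrite ?nnegrE ?expR_ge0//.
    apply: sumr_ge0 => j _; rewrite mulr_ge0// /q; case: ifP => // _; exact: ptail_ge0.
  apply: le_trans (expR_ge1Dx _).
  rewrite big_ord_recl /c /q /= mul1r lerD2l.
  set r := 2 `^ (alpha - 1).
  have r0 : 0 <= r by exact: powR_ge0.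
  have r1 : r < 1.
    rewrite /r -[X in _ < X](expR0 R) /powR pnatr_eq0/= ltr_expR.
    by rewrite pmulr_llt0 ?subr_lt0// ln_gt0// ltr1n.
  (* Halving the level halves the weight and multiplies the tail by 2^alpha, so that alpha < 1 makes
     the sum geometric. *)
  have H (j : nat) : 2 / 2 ^+ j.+1 * ptail (L / 2 ^+ j.+1) <= 2 * L `^ (- alpha) * r ^+ j.
    have Lj : 0 < L / 2 ^+ j.+1 by rewrite divr_gt0// exprn_gt0.
    apply: (@le_trans _ _ (2 / 2 ^+ j.+1 * (L / 2 ^+ j.+1) `^ (- alpha))).
      by rewrite ler_wpM2l ?ptail_le// divr_ge0// exprn_ge0.
    have -> : 2 / 2 ^+ j.+1 * (L / 2 ^+ j.+1) `^ (- alpha) = 2 * L `^ (- alpha) * r ^+ j.+1.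
      have XE : (2 ^+ j.+1)^-1 = 2 `^ (- j.+1%:R) :> R by rewrite powR_invn.
      rewrite powRM ?invr_ge0 ?exprn_ge0 ?(ltW L0)// XE -powRrM.
      have -> : r ^+ j.+1 = 2 `^ (- j.+1%:R) * 2 `^ (- j.+1%:R * - alpha).
        rewrite /r -powR_mulrn ?powR_ge0// -powRrM -powRD ?pnatr_eq0 ?implybT//.
        by congr (_ `^ _); ring.
      by ring.
    rewrite ler_wpM2l//; first by rewrite mulr_ge0// powR_ge0.
    by rewrite exprS ler_piMl ?exprn_ge0// ltW.
  apply: (@le_trans _ _ (\sum_(j < J.+1) 2 * L `^ (- alpha) * r ^+ j)).
    by apply: ler_sum => j _; exact: H.
  rewrite -mulr_sumr /upper_const -/r mulrAC; apply: ler_wpM2r; first exact: powR_ge0.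
  rewrite ler_wpM2l// -div1r ler_pdivlMr ?subr_gt0// mulrC.
  have h := subrX1 r J.+1.
  have -> : (1 - r) * \sum_(i < J.+1) r ^+ i = 1 - r ^+ J.+1.
    by rewrite -[RHS]opprB h -mulNr opprB.
  by rewrite gerBl exprn_ge0.
move=> w /= /negP; rewrite -ltNge => hw t1.
have E u : 1 < u -> expR (Num.min (u / L) 1 / 2) <= simplef J.+2 c D u.
  move=> u1; set y := Num.min _ _.
  have y0 : 0 <= y by rewrite /y le_min ler01 divr_ge0// ltW// (lt_trans _ u1).
  have y1 : y <= 1 by rewrite /y ge_min lexx orbT.
  have hy : y <= \sum_(j < J.+1) (2 ^- j) * (L / 2 ^+ j.+1 < u)%R%:R.
    by apply: min_le_dyadic => //; exact: le_lt_trans LJ u1.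
  (* On [0,1], expR (y / 2) <= 1 / (1 - y / 2) <= 1 + y. *)
  apply: (@le_trans _ _ (1 + y)).
    rewrite -[expR _]invrK -expRN.
    have h := expR_ge1Dx (- (y / 2)).
    have h2 : 0 < 1 + - (y / 2) by lra.
    apply: (@le_trans _ _ (1 + - (y / 2))^-1).
      by rewrite lef_pV2 ?posrE// expR_gt0.
    by rewrite -div1r ler_pdivrMr//; nra.
  rewrite /simplef big_ord_recl /c /D /= mul1r indicT lerD2l.
  apply: le_trans hy _; apply: ler_sum => j _.
  rewrite indicE mem_setE in_itv/= andbT ler_wpM2r//.
  by rewrite /bump/= add1n exprS invfM mulrA divff// mul1r.
rewrite mulrC -ler_pdivrMr// leNgt; apply/negP => ha.
move: hw; apply/negP; rewrite -leNgt.
apply: (@le_trans _ _ (\prod_(i <- s) expR (Num.min (tau i w / L) 1 / 2))).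
  by rewrite -expR_sum ler_expR -mulr_suml ltW.
by apply: ler_prod => i _; rewrite expR_ge0/= E.
Qed.

End Tails.

Arguments ptail {R}.
Arguments upper_const {R}.


(** * Borel-Cantelli arguments *)

Section BorelCantelli.
Context d (Omega : measurableType d) (R : realType) (P : probability Omega R).

Lemma sum_inv_sqr_le (C : R) M : 0 <= C ->
  \sum_(0 <= n < M) C / n.+1%:R ^+ 2 <= 2 * C.
Proof.
move=> C0.
case: M => [|M]; first by rewrite big_nil mulr_ge0.
suff h : \sum_(0 <= n < M.+1) C / n.+1%:R ^+ 2 <= C * (2 - M.+1%:R^-1).
  by apply: le_trans h _; rewrite mulrC ler_wpM2r// gerBl invr_ge0.
elim: M => [|M IH]; first by rewrite big_nat1 expr1n !divr1 invr1; lra.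
rewrite big_nat_recr//=; apply: le_trans (lerD IH (lexx _)) _.
rewrite -mulrDr ler_wpM2l//.
have M0 : 0 < M.+1%:R :> R by rewrite ltr0n.
rewrite -[M.+2%:R]natr1; set m := M.+1%:R in M0 *.
have m1 : 0 < m + 1 by rewrite addr_gt0.
rewrite -addrA lerD2l -subr_ge0.
have -> : - (m + 1)^-1 - (- m^-1 + ((m + 1) ^+ 2)^-1) = (m * (m + 1) ^+ 2)^-1.
  by field; rewrite !gt_eqF.
by rewrite invr_ge0 mulr_ge0 ?exprn_ge0 ?ltW.
Qed.

(** First Borel-Cantelli lemma. The exceptional sets [A] carry the measurability, so [Q] can be any
    predicate; [good] is for almost sure properties that are used pointwise. *)
Lemma ae_eventually (good : Omega -> Prop) (Q : nat -> Omega -> Prop) (C : R) (n0 : nat) :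
  0 <= C ->
  (forall n, (n0 <= n)%N -> exists A, [/\ measurable A,
     (P A <= (C / n%:R ^+ 2)%:E)%E & forall w, ~ A w -> good w -> Q n w]) ->
  {ae P, forall w, good w -> exists N, forall n, (N <= n)%N -> Q n w}.
Proof.
move=> C0 h.
have h' n : exists A, [/\ measurable A,
     (P A <= (C / n.+1%:R ^+ 2)%:E)%E & forall w, ~ A w -> good w -> Q (n + n0).+1 w].
  have [A [mA PA QA]] := h (n + n0).+1 ltac:(lia).
  exists A; split => //; apply: le_trans PA _.
  rewrite lee_fin ler_wpM2l// lef_pV2 ?posrE ?exprn_gt0 ?ltr0n//.
  by rewrite ler_pXn2r// ?nnegrE// ler_nat; lia.
have [F hF] := choice h'.
exists (lim_sup_set F); split.
- apply: bigcap_measurableType => n _; apply: bigcup_measurable => j _.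
  by have [] := hF j.
- apply: lim_sup_set_cvg0 => [k|]; first by have [] := hF k.
  apply: (@le_lt_trans _ _ (2 * C)%:E); last exact: ltry.
  apply: lime_le; first by apply: is_cvg_nneseries => n _ _; exact: measure_ge0.
  apply: nearW => M.
  apply: (@le_trans _ _ (\sum_(0 <= n < M) (C / n.+1%:R ^+ 2)%:E)%E).
    by apply: lee_sum => n _; have [] := hF n.
  by rewrite sumEFin lee_fin sum_inv_sqr_le.
move=> w /= hw; apply: contrapT => nF; apply: hw => gw.
have [n nP] : exists n, forall j, (n <= j)%N -> ~ F j w.
  apply: contrapT => /forallNP H; apply: nF => n _.
  have /existsNP[j /not_implyP[nj /contrapT Fj]] := H n.
  by exists j.
exists (n + n0).+1 => m hm.
have [_ _ /(_ w)] := hF (m - n0.+1)%N.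
have -> : ((m - n0.+1 + n0).+1 = m)%N by lia.
by apply => //; apply: nP; lia.
Qed.

End BorelCantelli.

(** * Second Borel-Cantelli lemma for maxima over disjoint blocks *)

Section Blocks.
Context d (Omega : measurableType d) (R : realType) (P : probability Omega R).
Variable tau : int -> Omega -> R.
Hypothesis mtau : forall x, measurable_fun setT (tau x).
Hypothesis itau : mutually_independent_rvs P tau.
Variables (blk : nat -> seq int) (u : nat -> R) (b : bool).

Definition block_le (n : nat) : set Omega := rect tau (blk n) (fun=> [set` `]-oo, u n]]).
(** The event that must fail infinitely often: [b = true] serves to find blocks with a large value,
    [b = false] to find blocks with none. *)
Definition block_event (n : nat) : set Omega := if b then block_le n else ~` block_le n.

Lemma measurable_block_le n : measurable (block_le n).
Proof. by apply: measurable_rect => // i; exact: measurable_itv. Qed.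

Lemma measurable_block_event n : measurable (block_event n).
Proof.
rewrite /block_event; case: ifP => _; [|apply: measurableC]; exact: measurable_block_le.
Qed.

(** The trailing rectangle lets the induction absorb [block_le n]. Its complement is not a
    rectangle; that case is the difference of two instances of the induction hypothesis. *)
Lemma prob_block_events_rect (F : seq nat) s' B :
  uniq (flatten [seq blk n | n <- F] ++ s') -> (forall i, measurable (B i)) ->
  P (\big[setI/setT]_(n <- F) block_event n `&` rect tau s' B) =
  ((\prod_(n <- F) P (block_event n)) * P (rect tau s' B))%E.
Proof.
elim: F s' B => [|n F IH] s' B /= us mB; first by rewrite !big_nil setTI mul1e.
rewrite !big_cons.
pose B' i := if i \in blk n then [set` `]-oo, u n]] else B i.
have mB' i : measurable (B' i) by rewrite /B'; case: ifP.
have us1 : uniq (blk n ++ s').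
  move: us; rewrite -catA !cat_uniq => /and3P[-> /hasPn h /and3P[_ _ ->]].
  rewrite andbT /=; apply/hasPn => x xs'; apply: h.
  by rewrite mem_cat xs' orbT.
have us2 : uniq (flatten [seq blk n | n <- F] ++ blk n ++ s').
  by rewrite uniq_catCA catA.
have us3 : uniq (flatten [seq blk n | n <- F] ++ s').
  by move: us2; rewrite uniq_catCA cat_uniq => /and3P[].
set H := \big[_/_]_(_ <- F) _.
have mH : measurable H by apply: bigsetI_measurable => j _; exact: measurable_block_event.
have Rc : block_le n `&` rect tau s' B = rect tau (blk n ++ s') B'.
  exact: rect_disjoint_cat.
have IH1 := IH _ _ us2 mB'; have IH2 := IH _ _ us3 mB.
have PR : P (rect tau (blk n ++ s') B') = (P (block_le n) * P (rect tau s' B))%E.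
  by rewrite -Rc; apply: prob_rect_disjoint => // i; exact: measurable_itv.
have mR := measurable_rect _ _ _ _ mtau s' _ mB.
have [->|->] : block_event n = block_le n \/ block_event n = ~` block_le n.
- by rewrite /block_event; case: (b); [left|right].
- by rewrite [block_le n `&` H]setIC -setIA Rc IH1 PR muleCA muleA.
rewrite (_ : _ `&` _ = (H `&` rect tau s' B) `\` (block_le n)); last first.
  by rewrite setDE -setIA setIC.
have -> : P ((H `&` rect tau s' B) `\` block_le n) =
    (P (H `&` rect tau s' B) - P (H `&` rect tau s' B `&` block_le n))%E.
  apply: measureD; [exact: measurableI|exact: measurable_block_le|].
  by rewrite ltey_eq fin_num_measure//; exact: measurableI.
have -> : H `&` rect tau s' B `&` block_le n = H `&` rect tau (blk n ++ s') B'.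
  by rewrite -Rc -setIA [X in _ = _ `&` X]setIC.
rewrite IH1 IH2 PR probability_setC; last exact: measurable_block_le.
have fin A : measurable A -> P A = (fine (P A))%:E.
  by move=> mA; rewrite fineK// fin_num_measure.
rewrite (fin _ (measurable_block_le n)) (fin _ mR).
have -> : (\prod_(j <- F) P (block_event j) = (\prod_(j <- F) fine (P (block_event j)))%:E)%E.
  rewrite -prodEFin; apply: eq_bigr => j _; apply: fin; exact: measurable_block_event.
move: (\prod_(j <- F) _) (fine (P (block_le n))) (fine (P (rect tau s' B))) => x y z.
by apply: (congr1 EFin (_ : x * z - x * (y * z) = (1 - y) * x * z)); ring.
Qed.

(** By independence, all block events from N to M occur with probability at most expR (- c sum 1 /
    (n+1)), which tends to 0 as the harmonic series diverges. *)
Lemma ae_frequently (n0 : nat) (c : R) : 0 < c ->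
  (forall N M, (n0 <= N)%N -> uniq (flatten [seq blk n | n <- index_iota N M])) ->
  (forall n, (n0 <= n)%N -> (P (block_event n) <= (expR (- (c / n.+1%:R)))%:E)%E) ->
  {ae P, forall w, forall N, exists2 n, (N <= n)%N & ~ block_event n w}.
Proof.
move=> c0 ublk hP; apply: ae_foralln => N0.
pose N := maxn n0 N0.
pose E : set Omega := \bigcap_(n in [set n | (N <= n)%N]) block_event n.
have mE : measurable E by apply: bigcap_measurableType => n _; exact: measurable_block_event.
exists E; split => //; last first.
  move=> w /= hw n Nn; apply: contrapT => nH; apply: hw; exists n => //.
  by apply: leq_trans Nn; rewrite leq_maxr.
have hM M : (P E <= (expR (- (c * \sum_(N <= n < M) n.+1%:R^-1)))%:E)%E.
  apply: (@le_trans _ _ (P (\big[setI/setT]_(n <- index_iota N M) block_event n))).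
    apply: le_measure; rewrite ?inE//.
      by apply: bigsetI_measurable => j _; exact: measurable_block_event.
    move=> w Ew; rewrite -bigcap_seq => n /=; rewrite mem_index_iota => /andP[Nn _].
    exact: Ew.
  have := prob_block_events_rect (index_iota N M) [::] (fun=> setT).
  rewrite cats0 => /(_ (ublk _ _ (leq_maxl _ _)) (fun=> measurableT)).
  rewrite /rect big_nil setIT probability_setT mule1 => ->.
  have fE n : P (block_event n) = (fine (P (block_event n)))%:E.
    by rewrite fineK// fin_num_measure//; exact: measurable_block_event.
  under eq_bigr do rewrite fE.
  rewrite prodEFin lee_fin mulr_sumr -sumrN expR_sum big_seq_cond [leRHS]big_seq_cond.
  apply: ler_prod => n; rewrite andbT mem_index_iota => /andP[Nn _].
  rewrite fine_ge0//= -lee_fin -fE; apply: hP.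
  by apply: leq_trans Nn; exact: leq_maxl.
have dv (A : R) : exists M, A <= \sum_(N <= n < M) n.+1%:R^-1.
  apply: contrapT => /forallNP hA; apply: (@dvg_harmonic R).
  apply: nondecreasing_is_cvgn; first by apply: nondecreasing_series => k _ _; rewrite invr_ge0.
  exists (\sum_(0 <= n < N) n.+1%:R^-1 + `|A|) => _ [M _ <-]; rewrite /series/=.
  have i0 n : 0 <= n.+1%:R^-1 :> R by rewrite invr_ge0.
  have [MN|NM] := leqP M N.
    by rewrite [X in X + _](@big_cat_nat _ _ _ M)//= -addrA lerDl addr_ge0 ?sumr_ge0.
  rewrite (@big_cat_nat _ _ _ N)//=; last exact: ltnW.
  rewrite lerD2l; have /negP := hA M; rewrite -ltNge => /ltW h.
  by apply: le_trans h _; exact: ler_norm.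
have fE : P E = (fine (P E))%:E by rewrite fineK// fin_num_measure.
suff : P E = 0%E by [].
apply/eqP; rewrite eq_le measure_ge0 andbT leNgt; apply/negP => PE0.
rewrite fE lte_fin in PE0.
(* For this M, c S >= 1 / P(E), and expR (c S) > c S contradicts [hM]. *)
have [M hA] := dv ((c * fine (P E))^-1).
have := hM M; rewrite fE lee_fin; apply/negP; rewrite -ltNge expRN.
set S := \sum_(N <= n < M) _ in hA *.
have cS : (fine (P E))^-1 <= c * S.
  by rewrite -ler_pdivrMl// mulrC -invfM mulrC.
rewrite -[ltRHS]invrK ltf_pV2 ?posrE ?expR_gt0 ?invr_gt0//.
by apply: le_lt_trans cS _; have := expR_ge1Dx (c * S); lra.
Qed.

End Blocks.

Arguments block_le {d Omega R}.
Arguments block_event {d Omega R}.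


Lemma bernoulli_ineq (R : realDomainType) (p : R) n : 0 <= p <= 1 ->
  1 - n%:R * p <= (1 - p) ^+ n.
Proof.
move=> /andP[p0 p1]; elim: n => [|n IH]; first by rewrite mul0r subr0 expr0.
rewrite exprS -natr1; apply: (@le_trans _ _ ((1 - p) * (1 - n%:R * p))).
  have := mulr_ge0 (ler0n R n) (mulr_ge0 p0 p0); lra.
by rewrite ler_wpM2l// subr_ge0.
Qed.

(** * Almost sure volume growth *)

Section VolumeGrowth.
Context d (Omega : measurableType d) (R : realType) (P : probability Omega R).
Variables (tau : int -> Omega -> R) (alpha : R).
Hypothesis alpha0 : 0 < alpha.
Hypothesis alpha1 : alpha < 1.
Hypothesis mtau : forall x, measurable_fun setT (tau x).
Hypothesis itau : mutually_independent_rvs P tau.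
Hypothesis tail : forall x (u : R), 1 <= u ->
  P [set w | u < tau x w] = (u `^ (- alpha))%:E.

Let b : R := alpha^-1.
Let good (w : Omega) := forall x, 1 < tau x w.
Let V (w : Omega) (r : nat) : R := vol (fun x => tau x w) r.
Let W (w : Omega) (r : nat) : R := bivol (fun x => tau x w) r.
Let K : R := upper_const alpha.

(** A site exceeds the level x^b with probability 1 / x; the levels below are written as powers [b]
    for this reason. *)
Lemma powR_inv_exponent x : 0 <= x -> (x `^ b) `^ (- alpha) = x^-1.
Proof.
by move=> x0; rewrite -powRrM mulrN /b mulVf ?gt_eqF// powR_inv1.
Qed.

Lemma powR_ge1 (x : R) : 1 <= x -> 1 <= x `^ b.
Proof. by move=> x1; rewrite -(powRr0 x) ler_powR// invr_ge0 ltW. Qed.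

Lemma expRN_ln (x : R) : 0 < x -> expR (- ln x) = x^-1.
Proof. by move=> x0; rewrite expRN lnK. Qed.

Lemma expRN_2ln n : (0 < n)%N -> expR (- (2 * ln n%:R)) = (n%:R ^+ 2)^-1 :> R.
Proof.
move=> n0; have nR : 0 < n%:R :> R by rewrite ltr0n.
have -> : - (2 * ln n%:R) = - ln n%:R + - ln n%:R :> R by ring.
by rewrite expRD expRN_ln// -invfM expr2.
Qed.

Lemma ln_natr_le n : (0 < n)%N -> ln n%:R <= n%:R :> R.
Proof. by move=> n0; apply/ltW/ln_sublinear; rewrite ltr0n. Qed.

Lemma muln8_le_exp2 m : (6 <= m)%N -> (8 * m <= 2 ^ m)%N.
Proof.
elim: m => // m IH; rewrite leq_eqVlt => /predU1P[[<-]//|].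
by rewrite ltnS => m6; have h := IH m6; rewrite expnS; lia.
Qed.

(** The mean number of sites above the chosen level is 8 ln m. Fewer than 2 ln m of them occur with
    probability at most expR (2 ln m - 4 ln m) = m^(-2), which is summable. *)
Lemma ae_vol_ge : {ae P, forall w, good w -> exists N, forall m, (N <= m)%N ->
  ((2 ^ m)%:R / (8 * ln m%:R)) `^ b * (2 * ln m%:R) <= V w (2 ^ m)}.
Proof.
apply: (ae_eventually _ _ _ P good _ 1 6) => // m m6.
have m0 : (0 < m)%N by lia.
have l0 : 0 < ln m%:R :> R by rewrite ln_gt0// ltr1n; lia.
set l := ln m%:R in l0 *.
have x1 : 1 <= (2 ^ m)%:R / (8 * l).
  rewrite ler_pdivlMr ?mulr_gt0// mul1r.
  apply: (@le_trans _ _ (8 * m%:R)); first by rewrite ler_wpM2l ?ln_natr_le.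
  by rewrite -natrM ler_nat muln8_le_exp2.
have [A [mA PA hA]] := sum_lower_tail _ _ _ P _ _ alpha0 mtau itau tail (pwindow (2 ^ m)) _
  (2 * l) (pwindow_uniq _) (powR_ge1 _ x1).
exists A; split => //.
  apply: le_trans PA _; rewrite lee_fin size_pwindow powR_inv_exponent; last by rewrite (le_trans _ x1).
  rewrite mul1r -expRN_2ln// ler_expR -/l invf_div.
  rewrite [X in _ - X](_ : _ = 4 * l); first lra.
  by field; rewrite pnatr_eq0 expn_eq0.
by move=> w nA g; apply: hA => // x; apply/ltW/(lt_trans _ (g x)).
Qed.

Lemma prob_rect_le s u : uniq s -> 1 <= u ->
  P (rect tau s (fun=> [set` `]-oo, u]])) = ((1 - u `^ (- alpha)) ^+ size s)%:E.
Proof.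
move=> us u1; rewrite (prob_rect _ _ _ _ _ itau)//.
under eq_bigr => i do rewrite (prob_tau_le _ _ _ P _ _ mtau tail).
by rewrite prodEFin /ptail u1 big_const_seq count_predT -Monoid.iteropE.
Qed.

Lemma sum_min_eq (s : seq int) (f : int -> R) L : 0 < L ->
  {in s, forall x, f x <= L} ->
  \sum_(x <- s) f x = L * \sum_(x <- s) Num.min (f x / L) 1.
Proof.
move=> L0 fL; rewrite mulr_sumr; apply: eq_big_seq => x /fL h.
by rewrite min_l ?ler_pdivrMr ?mul1r// mulrCA divff ?mulr1// gt_eqF.
Qed.

(** At the level L = x^b the mean number of larger sites in the window is m^(-2): eventually there
    is none, and the volume is L times the truncated sum. In the constant [expR K + 1], the 1 is for
    a site above L and [expR K] for a large truncated sum. *)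
Lemma ae_bivol_le : {ae P, forall w, good w -> exists N, forall m, (N <= m)%N ->
  W w (2 ^ m) <= ((2 ^ m.+1)%:R * m%:R ^+ 2) `^ b * (4 * ln m%:R)}.
Proof.
apply: (ae_eventually _ _ _ P good _ (expR K + 1) 1) => [|m m1].
  by rewrite addr_ge0// expR_ge0.
have mR : 1 <= m%:R :> R by rewrite ler1n.
set x := (2 ^ m.+1)%:R * m%:R ^+ 2.
have x1 : 1 <= x by rewrite /x -natrX -natrM ler1n muln_gt0 !expn_gt0 m1.
have x0 : 0 < x by rewrite (lt_le_trans _ x1).
set L := x `^ b; have L1 : 1 <= L by exact: powR_ge1.
have L0 : 0 < L by rewrite (lt_le_trans _ L1).
have sN : (size (window (2 ^ m))) = (2 ^ m.+1)%N by rewrite size_window expnS mul2n.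
have Lx : L `^ (- alpha) = x^-1 by rewrite powR_inv_exponent// ltW.
have Np : (2 ^ m.+1)%:R * x^-1 = (m%:R ^+ 2)^-1 :> R.
  have e0 : (2 ^ m.+1)%:R != 0 :> R by rewrite pnatr_eq0 expn_eq0.
  by rewrite /x invfM mulrA divff// mul1r.
have [A [mA PA hA]] := sum_upper_tail _ _ _ P _ _ alpha0 mtau itau tail alpha1 (window (2 ^ m)) _
  (2 * ln m%:R) (window_uniq _) L0.
pose B := rect tau (window (2 ^ m)) (fun=> [set` `]-oo, L]]).
have mB : measurable B by apply: measurable_rect => // i; exact: measurable_itv.
exists (A `|` ~` B); split.
- by apply: measurableU => //; exact: measurableC.
- rewrite (le_trans (measureU2 _ mA (measurableC mB)))//.
  have PB : (P (~` B) <= ((m%:R ^+ 2)^-1)%:E)%E.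
    rewrite probability_setC// prob_rect_le ?window_uniq// -EFinB lee_fin lerBlDl -lerBlDr.
    rewrite -Np -Lx -sN; apply: bernoulli_ineq.
    by rewrite powR_ge0 Lx invf_le1.
  rewrite mulrDl mul1r EFinD; apply: leeD => //; apply: le_trans PA _.
  rewrite lee_fin Lx sN -mulrA Np expRD -expRN_2ln// mulrC ler_wpM2r ?expR_ge0//.
  rewrite ler_expR -/K ler_piMr//.
    exact: upper_const_ge0.
  by rewrite expR_le1 oppr_le0 mulr_ge0// ln_ge0.
move=> w /not_orP[nA /contrapT/rectP hB] g.
rewrite /W /bivol (sum_min_eq _ _ _ L0); last first.
  by move=> y /hB /=; rewrite in_itv.
rewrite ler_wpM2l ?(ltW L0)//; apply: le_trans (hA _ nA g) _; lra.
Qed.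

(** The exponent n^2 makes consecutive radii differ by the factor 2^(2n - 1), more than any power of
    n, while ln m with m = n^2 is still of order ln n. *)
Definition annulus (n : nat) : seq int :=
  [seq x <- window (2 ^ n ^ 2) | x \notin window (2 ^ n.-1 ^ 2)].

Lemma mem_window_exp2 m n x : (m <= n)%N -> x \in window (2 ^ m ^ 2) -> x \in window (2 ^ n ^ 2).
Proof.
move=> mn; rewrite !mem_window.
have : (2 ^ m ^ 2 <= 2 ^ n ^ 2)%N by rewrite leq_exp2l// leq_exp2r.
lia.
Qed.

Lemma annulus_uniq N M : uniq (flatten [seq annulus n | n <- index_iota N M]).
Proof.
rewrite /index_iota; move: (M - N)%N => k; elim: k N => [//|k IH] n /=.
rewrite cat_uniq IH andbT filter_uniq ?window_uniq//=.
apply/hasPn => x /flatten_mapP[j]; rewrite mem_iota mem_filter => jn /andP[xj _].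
rewrite /= /annulus mem_filter negb_and; apply/orP; right.
by apply: contra xj; apply: mem_window_exp2; lia.
Qed.

Lemma expRN_double_le (p : R) : 0 <= p -> p <= 2^-1 ->
  (expR (- (2 * p)) <= 1 - p).
Proof.
move=> p0 p1; rewrite expRN -[leLHS]mul1r ler_pdivrMr ?expR_gt0//.
have h := expR_ge1Dx (2 * p).
have := ler_wpM2l (_ : 0 <= 1 - p) h => /(_ ltac:(lra)) h2.
by apply: le_trans h2; nra.
Qed.

(* The level that [tau] stays below on the whole annulus with probability at
   least [1/n]. *)
Let Lsmall (n : nat) : R := ((2 ^ (n ^ 2).+2)%:R / ln n%:R) `^ b.

Lemma expn5_le_expn4 n : (8 <= n)%N -> (n ^ 5 <= 4 ^ n)%N.
Proof.
elim: n => // n IH; rewrite leq_eqVlt => /predU1P[[<-]//|].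
rewrite ltnS => n8; have h := IH n8; rewrite [(4 ^ _)%N]expnS.
apply: leq_trans (leq_mul (leqnn 4) h).
(* For n >= 8 the left side grows by at most (9/8)^5, which is less than 4. *)
have h1 : ((n.+1 * 8) ^ 5 <= (n * 9) ^ 5)%N by rewrite leq_exp2r//; lia.
rewrite !expnMn in h1; rewrite -(@leq_pmul2r (8 ^ 5))//; apply: leq_trans h1 _.
by rewrite [leqRHS]mulnAC [leqRHS]mulnC leq_mul2l; apply/orP; right; vm_compute.
Qed.

Lemma bivol_annulus w n : bivol (fun x => tau x w) (2 ^ n ^ 2) =
  \sum_(x <- annulus n) tau x w + bivol (fun x => tau x w) (2 ^ n.-1 ^ 2).
Proof.
rewrite /bivol (bigID (mem (window (2 ^ n.-1 ^ 2))))/= addrC /annulus big_filter.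
congr (_ + _); rewrite -big_filter; apply: perm_big; apply: uniq_perm.
- exact/filter_uniq/window_uniq.
- exact: window_uniq.
move=> x; rewrite mem_filter; apply: andb_idr; apply: mem_window_exp2; exact: leq_pred.
Qed.

Lemma inner_volume_le (n : nat) : (9 <= n)%N ->
  ((2 ^ (n.-1 ^ 2).+1)%:R * (n.-1 ^ 2)%:R ^+ 2) `^ b * (4 * ln (n.-1 ^ 2)%:R) <=
  Lsmall n * (8 * ln n%:R) :> R.
Proof.
move=> n9; have n0 : 0 < n%:R :> R by rewrite ltr0n; lia.
have l0 : 0 < ln n%:R :> R by rewrite ln_gt0// ltr1n; lia.
have nn : (n.-1 ^ 2 <= n ^ 2)%N by rewrite leq_exp2r//; exact: leq_pred.
apply: ler_pM; first exact: powR_ge0.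
- by rewrite mulr_ge0// ln_ge0// ler1n expn_gt0; lia.
- apply: ge0_ler_powR; rewrite ?nnegrE ?mulr_ge0 ?invr_ge0 ?(ltW l0)//; first by rewrite ltW.
  rewrite ler_pdivlMr//; apply: (@le_trans _ _ (((2 ^ (n.-1 ^ 2).+1) * n ^ 5)%:R)).
    rewrite -natrX -natrM; apply: (@le_trans _ _ ((2 ^ (n.-1 ^ 2).+1 * (n.-1 ^ 2) ^ 2)%:R * n%:R)).
      by rewrite ler_wpM2l// ln_natr_le; lia.
    rewrite -natrM ler_nat -mulnA leq_mul2l [(n ^ 5)%N]expnSr leq_mul2r.
    by rewrite -expnM leq_exp2r// leq_pred !orbT.
  (* The polynomial factors are at most n^5 <= 2^(2n), and the exponents match: (n-1)^2 + 1 + 2n =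
     n^2 + 2. *)
  rewrite ler_nat; apply: leq_trans (leq_mul (leqnn _) (expn5_le_expn4 _ _)) _; first lia.
  rewrite -[4%N]/(2 ^ 2)%N -expnM -expnD leq_exp2l//.
  by case: n n9 {n0 l0 nn} => // n _ /=; rewrite -!mulnn; lia.
- have -> : 8 * ln n%:R = 4 * ln (n ^ 2)%:R :> R by rewrite natrX lnXn// mulr2n; ring.
  rewrite ler_wpM2l// ler_ln ?posrE ?ltr0n ?expn_gt0 ?ler_nat//; lia.
Qed.

(** Only the absence of large sites in an annulus is a recurrent event ([H2]). The truncated sum
    ([H1]) and the inner window ([H3]) are controlled for all large n, so no joint probability has
    to be estimated. They contribute 4 + K and 8 to the constant. *)
Lemma ae_bivol_small_le : {ae P, forall w, good w -> forall N, exists2 n, (N <= n)%N &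
  W w (2 ^ n ^ 2) <= (12 + K) * Lsmall n * ln n%:R}.
Proof.
have x1 n : (8 <= n)%N -> 2 <= (2 ^ (n ^ 2).+2)%:R / ln n%:R :> R.
  move=> n8; have l0 : 0 < ln n%:R :> R by rewrite ln_gt0// ltr1n; lia.
  rewrite ler_pdivlMr//; apply: (@le_trans _ _ (2 * n%:R)); first by rewrite ler_wpM2l// ln_natr_le; lia.
  rewrite -natrM ler_nat expnS leq_mul2l/= expnS.
  have : (n < 2 ^ n ^ 2)%N; last lia.
  apply: leq_trans (ltn_expl n (ltnSn 1)) _; rewrite leq_exp2l// -mulnn leq_pmulr//; lia.
have L1 n : (8 <= n)%N -> 1 <= Lsmall n.
  by move=> /x1 h; apply: powR_ge1; apply: le_trans h; rewrite ler1n.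
have Lp n : (8 <= n)%N -> Lsmall n `^ (- alpha) = ln n%:R / (2 ^ (n ^ 2).+2)%:R.
  by move=> /x1 h; rewrite powR_inv_exponent ?invf_div// (le_trans _ h).
have sN n : size (window (2 ^ n ^ 2)) = (2 ^ (n ^ 2).+1)%N by rewrite size_window [RHS]expnS mul2n.
have Np n : (8 <= n)%N -> (2 ^ (n ^ 2).+1)%:R * Lsmall n `^ (- alpha) = ln n%:R / 2.
  move=> n8; rewrite Lp// [in X in _ / X]expnS natrM; field.
  by rewrite pnatr_eq0 expn_eq0.
have H1 : {ae P, forall w, good w -> exists N, forall n, (N <= n)%N ->
    \sum_(x <- window (2 ^ n ^ 2)) Num.min (tau x w / Lsmall n) 1 <= (4 + K) * ln n%:R}.
  apply: (ae_eventually _ _ _ P good _ 1 8) => // n n8.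
  have L0 : 0 < Lsmall n by rewrite (lt_le_trans _ (L1 _ n8)).
  have [A [mA PA hA]] := sum_upper_tail _ _ _ P _ _ alpha0 mtau itau tail alpha1
    (window (2 ^ n ^ 2)) _ ((2 + K / 2) * ln n%:R) (window_uniq _) L0.
  exists A; split => //.
    apply: le_trans PA _; rewrite lee_fin sN -mulrA Np//.
    rewrite mul1r -expRN_2ln; last lia.
    by rewrite ler_expR -/K; lra.
  by move=> w nA g; apply: le_trans (hA _ nA g) _; lra.
have H2 : {ae P, forall w, forall N, exists2 n, (N <= n)%N &
    {in annulus n, forall x, tau x w <= Lsmall n}}.
  have := ae_frequently _ _ _ P _ mtau itau annulus Lsmall false 8 1 ltr01.
  move=> /(_ (fun N M _ => annulus_uniq N M)) H.
  have {}H := H _; apply: filterS (H _).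
    move=> w hw N; have [n Nn] := hw N; rewrite /block_event => /contrapT/rectP h.
    by exists n => // x /h /=; rewrite in_itv.
  move=> n n8; rewrite /block_event probability_setC; last exact: measurable_block_le.
  rewrite /block_le prob_rect_le ?filter_uniq ?window_uniq ?L1// -EFinB lee_fin.
  set p := Lsmall n `^ (- alpha).
  have n0 : 0 < n%:R :> R by rewrite ltr0n; lia.
  have p0 : 0 <= p by exact: powR_ge0.
  have p1 : p <= 2^-1.
    have x0 : 0 < (2 ^ (n ^ 2).+2)%:R / ln n%:R :> R by rewrite (lt_le_trans _ (x1 _ n8)).
    by rewrite /p powR_inv_exponent ?(ltW x0)// lef_pV2 ?posrE// x1.
  (* The window has (ln n) / 2 sites above the level on average, and 1 - p >= expR (- 2 p) turns
     this into the divergent 1 / n. *)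
  have h1 : n%:R^-1 <= (1 - p) ^+ size (annulus n).
    apply: (@le_trans _ _ ((1 - p) ^+ (2 ^ (n ^ 2).+1))); last first.
      apply: ler_wiXn2l; [lra|lra|].
      by rewrite -sN /annulus size_filter count_size.
    apply: (@le_trans _ _ (expR (- (2 * p)) ^+ (2 ^ (n ^ 2).+1))); last first.
      apply: lerXn2r; rewrite ?nnegrE ?expR_ge0//; first lra.
      exact: expRN_double_le.
    rewrite -expRM_natl -expRN_ln// ler_expR mulrN mulrCA Np//.
    by rewrite mulrCA divff ?mulr1.
  apply: (@le_trans _ _ (1 - n%:R^-1)); first lra.
  apply: le_trans (expR_ge1Dx _) _; rewrite ler_expR lerN2 div1r lef_pV2 ?posrE//.
  by rewrite ler_nat.
have H3 := ae_bivol_le.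
apply: filterS3 H1 H2 H3 => w h1 h2 h3 g N.
have [N1 {}h1] := h1 g; have [N3 {}h3] := h3 g.
have [n Nn hn] := h2 (maxn 9 (maxn N (maxn N1 N3.+1))).
have [n9 [nN [nN1 nN3]]] : (9 <= n /\ N <= n /\ N1 <= n /\ N3 < n)%N by lia.
exists n => //; rewrite /W bivol_annulus.
have L0 : 0 < Lsmall n by rewrite (lt_le_trans _ (L1 _ _))//; lia.
have -> : (12 + K) * Lsmall n * ln n%:R =
  Lsmall n * ((4 + K) * ln n%:R) + Lsmall n * (8 * ln n%:R) by ring.
apply: lerD.
  rewrite (sum_min_eq _ _ _ L0 hn) ler_wpM2l ?(ltW L0)//.
  apply: le_trans (h1 _ nN1); apply: ler_sum_subseq.
  - exact/filter_uniq/window_uniq.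
  - exact: window_uniq.
  - by move=> x; rewrite mem_filter => /andP[].
  - by move=> x _; rewrite le_min ler01 divr_ge0 ?(ltW L0)// ltW// (lt_trans _ (g x)).
apply: le_trans (inner_volume_le _ n9); apply: h3.
by apply: (@leq_trans n.-1); [lia|rewrite -mulnn leq_pmulr//; lia].
Qed.

Definition dyadic_block (n : nat) : seq int := [seq i%:Z | i <- iota (2 ^ n) (2 ^ n)].

Lemma mem_dyadic_block n x : (x \in dyadic_block n) = ((2 ^ n)%:Z <= x < (2 ^ n.+1)%:Z).
Proof.
rewrite expnS; apply/mapP/idP => [[i]|xn].
  rewrite mem_iota => iN ->; lia.
exists (absz x); last by lia.
rewrite mem_iota; lia.
Qed.

Lemma dyadic_block_uniq1 n : uniq (dyadic_block n).
Proof. by rewrite map_inj_uniq ?iota_uniq// => i j []. Qed.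

Lemma dyadic_block_uniq N M : uniq (flatten [seq dyadic_block n | n <- index_iota N M]).
Proof.
rewrite /index_iota; move: (M - N)%N => k; elim: k N => [//|k IH] n /=.
rewrite cat_uniq IH andbT dyadic_block_uniq1 /=.
apply/hasPn => x /flatten_mapP[j]; rewrite mem_iota mem_dyadic_block => jn xj.
rewrite /= mem_dyadic_block.
have : (2 ^ n.+1 <= 2 ^ j)%N by rewrite leq_exp2l//; lia.
lia.
Qed.

(** One site of the block above the level is enough. The mean number of such sites is 1 /
    ((M+1)(n+1)), a divergent series for every M. *)
Lemma ae_vol_large_at (M : nat) : {ae P, forall w, good w -> forall N, exists2 n, (N <= n)%N &
  (M.+1%:R * (2 ^ n)%:R * n.+1%:R) `^ b <= V w (2 ^ n.+1)}.
Proof.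
pose x n : R := M.+1%:R * (2 ^ n)%:R * n.+1%:R.
have x1 n : 1 <= x n by rewrite /x -!natrM ler1n !muln_gt0 expn_gt0.
have H := ae_frequently _ _ _ P _ mtau itau dyadic_block (fun n => x n `^ b) true 0
  M.+1%:R^-1 _ (fun N M _ => dyadic_block_uniq N M) _.
have {}H := H ltac:(by rewrite invr_gt0); apply: filterS (H _).
  move=> w hw g N; have [n Nn] := hw N; rewrite /block_event /block_le => h.
  exists n => //.
  have [y yn hy] : exists2 y, y \in dyadic_block n & x n `^ b < tau y w.
    apply: contrapT => hy; apply: h; apply/rectP => y yn /=; rewrite in_itv/= leNgt.
    by apply/negP => hlt; apply: hy; exists y.
  apply: (le_trans (ltW hy)).
  have -> : tau y w = \sum_(z <- [:: y]) tau z w by rewrite big_seq1.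
  apply: ler_sum_subseq => //; first exact: pwindow_uniq.
    move=> z; rewrite inE => /eqP ->; move: yn; rewrite mem_dyadic_block mem_pwindow; lia.
  by move=> z _; apply/ltW/(lt_trans _ (g z)).
move=> n _; rewrite /block_event /block_le prob_rect_le ?dyadic_block_uniq1 ?powR_ge1//.
rewrite powR_inv_exponent ?(le_trans _ (x1 n))// lee_fin size_map size_iota.
have x0 : 0 < x n by rewrite (lt_le_trans _ (x1 n)).
apply: (@le_trans _ _ (expR (- (x n)^-1) ^+ (2 ^ n))).
  apply: lerXn2r; rewrite ?nnegrE ?expR_ge0// ?subr_ge0 ?invf_le1//.
  by apply: le_trans (expR_ge1Dx _); lra.
rewrite -expRM_natl ler_expR mulrN lerN2 /x !invfM.
rewrite le_eqVlt; apply/orP; left; apply/eqP; field.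
by rewrite ![1 + _]addrC !natr1 !pnatr_eq0 expn_eq0.
Qed.

Lemma ae_vol_large : {ae P, forall w, forall M, good w -> forall N,
  exists2 n, (N <= n)%N & (M.+1%:R * (2 ^ n)%:R * n.+1%:R) `^ b <= V w (2 ^ n.+1)}.
Proof. by apply: ae_foralln => M; exact: ae_vol_large_at. Qed.

End VolumeGrowth.


(** * Asymptotics *)

Section LogFacts.
Variable R : realType.
Implicit Types x y t : R.

Lemma powR_expR x a : 0 < x -> x `^ a = expR (a * ln x).
Proof. by move=> x0; rewrite /powR gt_eqF. Qed.

Lemma ln_exp2 m : ln (2 ^ m)%:R = m%:R * ln 2 :> R.
Proof. by rewrite natrX lnXn// mulr_natl. Qed.

Lemma ln2_ge : 2^-1 <= ln 2 :> R.
Proof.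
have := @le_ln1Dx R (- 2^-1) ltac:(lra).
rewrite (_ : 1 + - 2^-1 = 2^-1); last by field.
by rewrite lnV ?posrE//; lra.
Qed.

Lemma ln2_le1 : ln 2 <= 1 :> R.
Proof.
by rewrite -ler_expR lnK ?posrE//; have := expR_ge1Dx (1 : R); lra.
Qed.

Lemma ln_le_expR x y : 0 < x -> (ln x <= y) = (x <= expR y).
Proof. by move=> x0; rewrite -ler_expR lnK. Qed.

Lemma ln_ge_expR x y : 0 < x -> (y <= ln x) = (expR y <= x).
Proof. by move=> x0; rewrite -ler_expR lnK. Qed.

Lemma ln_le x y : 0 < x -> x <= y -> ln x <= ln y.
Proof. by move=> x0 xy; rewrite ler_ln ?posrE// (lt_le_trans x0). Qed.

Lemma ln_le_self x : 0 < x -> ln x <= x.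
Proof. by move=> x0; exact/ltW/ln_sublinear. Qed.

Lemma expR_gt_self x : x < expR x.
Proof. by have := expR_ge1Dx x; lra. Qed.

Lemma lnlog_large (Y t : R) : expR (expR Y) <= t ->
  [/\ 0 < t, expR Y <= ln t, 0 < ln t & Y <= ln (ln t)].
Proof.
move=> h; have t0 : 0 < t by apply: lt_le_trans h; exact: expR_gt0.
have h1 : expR Y <= ln t by rewrite ln_ge_expR.
have l0 : 0 < ln t by apply: lt_le_trans h1; exact: expR_gt0.
by split => //; rewrite ln_ge_expR.
Qed.

End LogFacts.

Lemma sqr_sub2_ge n : (6 <= n)%N -> (6 * n <= n ^ 2)%N /\ (n <= n ^ 2 - 2)%N.
Proof. by move=> n6; rewrite -mulnn; split; [rewrite leq_mul2r n6 orbT|nia]. Qed.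

(** These relations are all that is used of the exponents, with which the estimates on logarithms
    become linear arithmetic. *)
Record exponents (R : realType) (alpha b gam kap : R) : Prop := Exponents {
  exponent_b_gt1 : 1 < b;
  exponent_gam_gt0 : 0 < gam;
  exponent_kap_gt0 : 0 < kap;
  exponent_kap_le : kap <= gam;
  exponent_gam_b : gam * (1 + b) = b;
  exponent_alpha_gam : alpha * gam = 1 - gam;
  exponent_b_kap : b * kap = b - 1 - kap;
  exponent_gam_b1 : gam * (b - 1) = b - 1 - kap;
  exponent_b_alpha_gam : b * (alpha * gam) = gam }.

Lemma exponentsP (R : realType) (alpha : R) : 0 < alpha -> alpha < 1 ->
  exponents R alpha alpha^-1 (1 + alpha)^-1 ((1 - alpha) / (1 + alpha)).
Proof.
move=> a0 a1; have a2 : 0 < 1 + alpha by rewrite addr_gt0.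
have a3 : 1 + alpha != 0 by rewrite gt_eqF.
have a4 : alpha != 0 by rewrite gt_eqF.
split; try by field; rewrite ?a3 ?a4.
- by rewrite invf_gt1.
- by rewrite invr_gt0.
- by rewrite divr_gt0 ?subr_gt0.
- by rewrite ler_piMl ?invr_ge0 ?(ltW a2)// gerBl ltW.
Qed.

(** Rounds the radius expR rho down to a power of 2. *)
Lemma exists_exp2 (R : realType) (rho : R) : 0 <= rho -> exists m : nat, m%:R * (ln 2) <= rho < m%:R * (ln 2) + (ln 2).
Proof.
move=> r0; have l0 : 0 < ln 2 :> R by have := ln2_ge R; lra.
exists (Num.truncn (rho / (ln 2))).
have /andP[h1 h2] : (Num.truncn (rho / (ln 2)))%:R <= rho / (ln 2) < (Num.truncn (rho / (ln 2))).+1%:R.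
  by apply: truncn_itv; rewrite divr_ge0// ltW.
rewrite -ler_pdivlMr// h1 /=; move: h2; by rewrite ltr_pdivrMr// -natr1 mulrDl mul1r.
Qed.

Lemma exists_nat_ge (R : realType) (x : R) : exists n : nat, x <= n%:R.
Proof.
exists (Num.truncn `|x|).+1.
have /andP[_ /ltW h] := truncn_itv (normr_ge0 x).
by apply: le_trans h; exact: ler_norm.
Qed.

Lemma V_ge_expR (R : realType) (b : R) (V : nat -> R) :
  (exists N, forall m, (N <= m)%N ->
    ((2 ^ m)%:R / (8 * ln m%:R)) `^ b * (2 * ln m%:R) <= V (2 ^ m)%N) ->
  exists N, forall m, (N <= m)%N ->
  expR (b * (m%:R * ln 2 - ln 8) - (b - 1) * ln (ln m%:R)) <= V (2 ^ m)%N.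
Proof.
move=> [N hN]; exists (maxn N 3) => m hm.
have m3 : (3 <= m)%N by apply: leq_trans hm; exact: leq_maxr.
have l0 : 0 < ln m%:R :> R by rewrite ln_gt0// ltr1n; exact: leq_trans m3.
apply: le_trans (hN m _); last by apply: leq_trans hm; exact: leq_maxl.
have x0 : 0 < (2 ^ m)%:R / (8 * ln m%:R) :> R.
  by rewrite divr_gt0 ?mulr_gt0// ltr0n expn_gt0.
rewrite powR_expR// ln_div ?posrE ?mulr_gt0// ?ltr0n ?expn_gt0// ln_exp2 lnM ?posrE//.
apply: (@le_trans _ _ (expR (b * (m%:R * ln 2 - (ln 8 + ln (ln m%:R)))) * ln m%:R)); last first.
  by rewrite ler_wpM2l ?expR_ge0//; lra.
pose X := b * (m%:R * ln 2 - (ln 8 + ln (ln m%:R))); have -> : expR X * ln m%:R = expR (X + ln (ln m%:R)).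
  by rewrite expRD [expR (ln _)]lnK.
rewrite ler_expR /X; lra.
Qed.

(** * The four estimates in the coordinates T = ln t and S = ln ln t *)

Definition rate (R : realType) (gam kap t : R) : R :=
  t `^ (- gam) * ln (ln t) `^ kap.

Lemma rateE (R : realType) (gam kap t : R) : 0 < t -> 0 < ln (ln t) ->
  rate R gam kap t = expR (- gam * ln t + kap * ln (ln (ln t))).
Proof. by move=> t0 S0; rewrite /rate !powR_expR// expRD. Qed.

(** The radius t^(alpha gam) (ln ln t)^kap makes r / t equal to the rate, and 1 / V(r) matches it up
    to a constant because - b kap + (b - 1) = kap. *)
Lemma limsup_upper (R : realType) (alpha b gam kap : R) (p : R -> R) (V : nat -> R) :
  0 < alpha -> exponents R alpha b gam kap ->
  (forall r, (0 < r)%N -> 0 < V r) ->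
  (forall t r, 8 <= t -> (0 < r)%N -> p t <= 2 / V r + 130 * r%:R / t) ->
  (exists N, forall m, (N <= m)%N ->
    ((2 ^ m)%:R / (8 * ln m%:R)) `^ b * (2 * ln m%:R) <= V (2 ^ m)%N) ->
  exists C A, forall t, A <= t -> p t / rate R gam kap t <= C.
Proof.
move=> alpha0 [E4 E5 E6 E7 b_gam a_gam b_kap g_kap b_agam] V_gt0 p_le V_ge.
have [e2 e2E] : exists e2 : R, ln 2 = e2 by exists (ln 2).
have E1 : 2^-1 <= e2 by rewrite -e2E; exact: ln2_ge.
have E2 : e2 <= 1 by rewrite -e2E; exact: ln2_le1.
have E3 : 0 < e2 by apply: lt_le_trans E1; rewrite invr_gt0.
have [N hN] := V_ge_expR _ _ _ V_ge; rewrite e2E in hN.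
have [C1 C1E] : exists y : R, y = 2 * expR (b * (e2 + ln 8) + (b - 1) * e2) by eexists.
have ag0 : 0 < alpha * gam by exact: mulr_gt0.
(* The quotient makes [rho] at least N + 4, hence N < m. *)
have [Y YE] : exists y : R, y = (N%:R + 4) / (alpha * gam) + 8 by eexists.
have Y8 : 8 <= Y by rewrite YE lerDr divr_ge0 ?addr_ge0 ?(ltW ag0).
exists (C1 + 130), (expR (expR Y)) => t /lnlog_large[t0 hT T0 hS].
have [T TE] : exists y : R, ln t = y by eexists.
have [S SE] : exists y : R, ln T = y by eexists.
rewrite TE SE in hT T0 hS *.
have S0 : 0 < S by clear -Y8 hS; lra.
have lnS0 : 0 <= ln S by rewrite ln_ge0//; clear -Y8 hS; lra.
have lnSS : ln S <= S by exact: ln_le_self.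
have ST : S <= T by rewrite -SE; exact: ln_le_self.
have TT : t = expR T by rewrite -TE lnK.
have YT : Y <= T by clear -hS ST; lra.
have t8 : 8 <= t by rewrite TT; have := expR_gt_self _ T; clear -Y8 YT; lra.
have [rho rhoE] : exists y : R, y = alpha * gam * T + kap * ln S by eexists.
have gT : kap * ln S <= gam * T.
  by apply: ler_pM => //; [exact: ltW|(clear -lnSS ST; lra)].
have agT : N%:R + 4 <= alpha * gam * T.
  by rewrite mulrC -ler_pdivrMr//; rewrite YE in YT; clear -YT; lra.
have kS0 : 0 <= kap * ln S by rewrite mulr_ge0 ?(ltW E6).
have rho0 : 0 <= rho by rewrite rhoE; have := ler0n R N; clear -agT kS0; lra.
have rhoT : rho <= T by rewrite rhoE a_gam; clear -gT; lra.
have [m /andP[m1 m2]] := exists_exp2 _ _ rho0; rewrite e2E in m1 m2.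
have mNR : N%:R + 3 < m%:R :> R.
  have h : (N%:R + 3) * e2 < m%:R * e2.
    have : (N%:R + 4) * e2 <= N%:R + 4 by rewrite ler_piMr ?addr_ge0.
    by rewrite rhoE in m2; clear -m2 agT kS0; lra.
  by move: h; rewrite ltr_pM2r.
have mN : (N < m)%N by rewrite -(ltr_nat R); clear -mNR; lra.
have m3 : 3 <= m%:R :> R by have := ler0n R N; clear -mNR; lra.
have V1 := hN m (ltnW mN).
have l1 : ln m%:R <= 2 * S.
  have h : m%:R <= 2 * T.
    have : m%:R * 2^-1 <= m%:R * e2 by rewrite ler_wpM2l.
    clear -m1 rhoT; lra.
  apply: (le_trans (ln_le _ _ _ _ h)); first (clear -m3; lra).
  rewrite lnM ?posrE//; rewrite SE e2E; clear -E2 Y8 hS; lra.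
have lm0 : 0 < ln m%:R :> R by rewrite ln_gt0//; clear -m3; lra.
have l2 : ln (ln m%:R) <= ln S + e2.
  by apply: (le_trans (ln_le _ _ _ lm0 l1)); rewrite lnM ?posrE// e2E; clear -E1; lra.
have rE : rate R gam kap t = expR (- gam * T + kap * ln S).
  by rewrite rateE ?TE ?SE.
have r0 : 0 < rate R gam kap t by rewrite rE expR_gt0.
rewrite ler_pdivrMr// mulrDl.
apply: (le_trans (p_le t (2 ^ m)%N t8 _)); first by rewrite expn_gt0.
have m0 : 0 < (2 ^ m)%:R :> R by rewrite ltr0n expn_gt0.
apply: lerD.
  rewrite C1E -mulrA ler_wpM2l// rE -expRD.
  rewrite -[leRHS]invrK -expRN lef_pV2 ?posrE ?expR_gt0 ?V_gt0 ?expn_gt0//.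
  apply: le_trans V1; rewrite ler_expR.
  have h1 : b * (rho - e2) <= b * (m%:R * e2) by rewrite ler_wpM2l ?(ltW (lt_trans _ E4))//; clear -m2; lra.
  have h2 : (b - 1) * ln (ln m%:R) <= (b - 1) * (ln S + e2) by rewrite ler_wpM2l// subr_ge0 ltW.
  have h3 : b * rho = gam * T + (b - 1 - kap) * ln S.
    transitivity (b * (alpha * gam) * T + b * kap * ln S); first by rewrite rhoE; ring.
    by rewrite b_agam b_kap.
  clear -h1 h2 h3; lra.
rewrite -mulrA ler_wpM2l// [in leLHS]TT ler_pdivrMr ?expR_gt0// rE -expRD.
rewrite -ln_le_expR// ln_exp2 e2E; apply: le_trans m1 _; rewrite rhoE a_gam; clear -E1; lra.
Qed.

(** With r = 2^(n+1) and V(r) >= x^b, the time t = r x^b makes both terms multiples of x^(-b). Since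
    gam (1 + b) = b, t^gam x^(-b) = (r / x)^gam, of order (M n)^(-gam); as ln t is of order n, the
    product is of order M^(-gam), and M is arbitrary. *)
Lemma liminf_zero (R : realType) (alpha b gam kap : R) (p : R -> R) (V : nat -> R) :
  exponents R alpha b gam kap ->
  (forall r, (0 < r)%N -> 0 < V r) ->
  (forall t r, 8 <= t -> (0 < r)%N -> p t <= 2 / V r + 130 * r%:R / t) ->
  (forall M N, exists2 n, (N <= n)%N &
    (M.+1%:R * (2 ^ n)%:R * n.+1%:R) `^ b <= V (2 ^ n.+1)%N) ->
  forall eps A : R, 0 < eps ->
  exists2 t, A <= t & p t * ln t `^ gam / t `^ (- gam) <= eps.
Proof.
move=> [E4 E5 E6 E7 b_gam a_gam b_kap g_kap b_agam] V_gt0 p_le V_large.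
move=> eps A eps0.
have [e2 e2E] : exists e2 : R, ln 2 = e2 by exists (ln 2).
have E1 : 2^-1 <= e2 by rewrite -e2E; exact: ln2_ge.
have E2 : e2 <= 1 by rewrite -e2E; exact: ln2_le1.
have E3 : 0 < e2 by apply: lt_le_trans E1; rewrite invr_gt0.
have b_1gam : b * (1 - gam) = gam by rewrite -a_gam b_agam.
(* [e2] pays for 2^(n+1) against 2^n, the other term for ln t <= (1 + 3 b) (n + 1). *)
have [C0 C0E] : exists y : R, y = e2 + ln (1 + 3 * b) by eexists.
have [M hM] := exists_nat_ge _ (expR ((ln 132 - ln eps) / gam + C0)).
have [mu muE] : exists y : R, y = ln M.+1%:R by eexists.
have M0 : 0 < M.+1%:R :> R by rewrite ltr0n.
have hmu : (ln 132 - ln eps) / gam + C0 <= mu.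
  by rewrite muE ln_ge_expR//; apply: le_trans hM _; rewrite ler_nat.
have mu0 : 0 <= mu by rewrite muE ln_ge0// ler1n.
have [N1 hN1] := exists_nat_ge _ mu.
have [N2 hN2] := exists_nat_ge _ (2 * A).
have [n Nn hn] := V_large M (16 + (N1 + N2))%N.
have n16 : 16 + N1%:R + N2%:R <= n%:R :> R.
  by rewrite -addrA -!natrD ler_nat.
have N10 := ler0n R N1; have N20 := ler0n R N2.
have nS : n.+1%:R = n%:R + 1 :> R by rewrite natr1.
have nS0 : 0 < n.+1%:R :> R by rewrite ltr0n.
have p2 : 0 < (2 ^ n)%:R :> R by rewrite ltr0n expn_gt0.
have [x xE] : exists y : R, y = M.+1%:R * (2 ^ n)%:R * n.+1%:R by eexists.
have x0 : 0 < x by rewrite xE !mulr_gt0.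
have lx : ln x = mu + n%:R * e2 + ln n.+1%:R.
  by rewrite xE muE !lnM ?posrE ?mulr_gt0// ln_exp2 e2E.
have ln0 : 0 <= ln n.+1%:R :> R by rewrite ln_ge0// ler1n.
have lnle : ln n.+1%:R <= n.+1%:R :> R by exact: ln_le_self.
have ne2 : n%:R * 2^-1 <= n%:R * e2 by rewrite ler_wpM2l.
have ne2' : n%:R * e2 <= n%:R by rewrite ler_piMr.
have lx0 : 0 <= ln x by rewrite lx; clear -mu0 ne2 ln0 n16 N10 N20; lra.
have lx3 : ln x <= 3 * n.+1%:R by rewrite lx; clear -hN1 n16 N10 N20 ne2' lnle nS; lra.
have [T TE] : exists y : R, y = n.+1%:R * e2 + b * ln x by eexists.
have blx : 0 <= b * ln x by rewrite mulr_ge0//; clear -E4; lra.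
have T1 : n%:R / 2 <= T by rewrite TE nS; clear -ne2 blx E3; lra.
have T0 : 0 < T by clear -T1 n16 N10 N20; lra.
have TB : T <= (1 + 3 * b) * n.+1%:R.
  have h : b * ln x <= b * (3 * n.+1%:R) by rewrite ler_wpM2l//; clear -E4; lra.
  have h2 : n.+1%:R * e2 <= n.+1%:R by rewrite ler_piMr.
  by rewrite TE; clear -h h2; lra.
have lT : ln T <= ln (1 + 3 * b) + ln n.+1%:R.
  have b3 : 0 < 1 + 3 * b by clear -E4; lra.
  by apply: (le_trans (ln_le _ _ _ T0 TB)); rewrite lnM ?posrE.
exists (expR T); first by have := expR_gt_self _ T; clear -T1 n16 hN2 N10 N20; lra.
have p1 : p (expR T) <= 132 * expR (- (b * ln x)).
  have t8 : 8 <= expR T by have := expR_gt_self _ T; clear -T1 n16 N10 N20; lra.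
  apply: (le_trans (p_le _ (2 ^ n.+1)%N t8 _)); first by rewrite expn_gt0.
  have -> : 132 * expR (- (b * ln x)) = 2 * expR (- (b * ln x)) + 130 * expR (- (b * ln x)) by ring.
  apply: lerD.
    rewrite ler_wpM2l// expRN lef_pV2 ?posrE ?expR_gt0 ?V_gt0 ?expn_gt0//.
    by rewrite -powR_expR// xE.
  rewrite -mulrA ler_wpM2l// -expRN -[(2 ^ n.+1)%:R](lnK (x := _)) ?posrE ?ltr0n ?expn_gt0//.
  by rewrite -expRD ler_expR ln_exp2 e2E TE; clear -E1; lra.
rewrite expRK !powR_expR ?expR_gt0// expRK mulNr expRN invrK -mulrA -expRD.
apply: (le_trans (ler_wpM2r (expR_ge0 _) p1)).
rewrite -mulrA -expRD -[132](lnK (x := _)) ?posrE// -expRD -ln_ge_expR//.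
have g1 : gam * (b * ln x) = b * ln x - gam * ln x.
  transitivity ((b - b * (1 - gam)) * ln x); first by ring.
  by rewrite b_1gam; ring.
have g2 : gam * ln T <= gam * (ln (1 + 3 * b) + ln n.+1%:R) by rewrite ler_wpM2l ?(ltW E5).
have g3 : gam * T = gam * (n.+1%:R * e2) + (b * ln x - gam * ln x) by rewrite -g1 TE; ring.
have g4 : gam * ((ln 132 - ln eps) / gam + C0) <= gam * mu by rewrite ler_wpM2l ?(ltW E5).
have g5 : gam * ((ln 132 - ln eps) / gam + C0) = ln 132 - ln eps + gam * C0.
  by field; rewrite gt_eqF.
have g6 : gam * ln x = gam * mu + gam * (n%:R * e2) + gam * ln n.+1%:R by rewrite lx; ring.
have g7 : gam * (n.+1%:R * e2) = gam * (n%:R * e2) + gam * e2 by rewrite nS; ring.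
rewrite g7 in g3; rewrite g5 C0E in g4; rewrite mulrDr in g2; rewrite mulrDr in g4.
move: g2 g3 g4 g6 {g1 g5 g7}.
move: (gam * ln T) (gam * T) (gam * ln x) (b * ln x) => v1 v2 v3 v4.
move: (gam * (n%:R * e2)) (gam * ln n.+1%:R) (gam * mu) (gam * e2) => v5 v6 v7 v8.
by move: (gam * ln (1 + 3 * b)) (ln 132) (ln eps) => v9 v10 v11; clear -E1; lra.
Qed.

(** [p_ge] is applied at r = 2^(m-2) with m = n^2, so that 4 r is a radius where [W] is small. There
    V and W have the same order r^b (ln m)^(1 - b), and the gain (ln m)^(b - 1) in 1 / W leaves the
    power [kap] once t is expressed through r. *)
Lemma limsup_lower (R : realType) (alpha b gam kap K : R) (p : R -> R) (V W : nat -> R) :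
  exponents R alpha b gam kap ->
  (forall r, (0 < r)%N -> 0 < W r) ->
  0 <= K ->
  (forall t r, 0 < t -> (0 < r)%N -> 2 * t + 1 <= r%:R * V r ->
    (32 * W (4 * r)%N)^-1 <= p t) ->
  (exists N, forall m, (N <= m)%N ->
    ((2 ^ m)%:R / (8 * ln m%:R)) `^ b * (2 * ln m%:R) <= V (2 ^ m)%N) ->
  (forall N, exists2 n, (N <= n)%N &
    W (2 ^ n ^ 2)%N <= (12 + K) * ((2 ^ (n ^ 2).+2)%:R / ln n%:R) `^ b * ln n%:R) ->
  exists2 c, 0 < c & forall A, exists2 t, A <= t & c <= p t / rate R gam kap t.
Proof.
move=> [E4 E5 E6 E7 b_gam a_gam b_kap g_kap b_agam] W_gt0 K0 p_ge V_ge W_small.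
have [e2 e2E] : exists e2 : R, ln 2 = e2 by exists (ln 2).
have E1 : 2^-1 <= e2 by rewrite -e2E; exact: ln2_ge.
have E2 : e2 <= 1 by rewrite -e2E; exact: ln2_le1.
have E3 : 0 < e2 by apply: lt_le_trans E1; rewrite invr_gt0.
have [NV hV] := V_ge_expR _ _ _ V_ge; rewrite e2E in hV.
have ln80 : 0 <= ln 8 :> R by rewrite ln_ge0// ler1n.
have ln30 : 0 <= ln 3 :> R by rewrite ln_ge0// ler1n.
have [D DE] : exists y : R, y = b * ln 8 + ln 3 by eexists.
have D0 : 0 <= D by rewrite DE addr_ge0// mulr_ge0//; clear -E4; lra.
have [Q QE] : exists y : R, y = 4 * b * e2 + gam * (b - 1) * e2 + gam * (b * ln 8) + gam * ln 3 + kap * ln 3 by eexists.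
exists (expR (- Q) / (32 * (12 + K))).
  by rewrite divr_gt0 ?expR_gt0// mulr_gt0//; clear -K0; lra.
move=> A; have [N1 hN1] := exists_nat_ge _ (`|A| + D + b + 10).
have [n Nn hn] := W_small (6 + (N1 + NV))%N.
have n6 : 6 + N1%:R + NV%:R <= n%:R :> R by rewrite -addrA -!natrD ler_nat.
have NV0 := ler0n R NV; have A0 := normr_ge0 A.
set m := (n ^ 2)%N in hn *.
have mE : m%:R = n%:R ^+ 2 :> R by rewrite /m natrX.
have n6' : (6 <= n)%N by apply: leq_trans Nn; exact: leq_addr.
have nNV : (NV <= n)%N by apply: leq_trans Nn; rewrite addnA leq_addl.
have [mn nm2] := sqr_sub2_ge _ n6'; rewrite -/m in mn nm2.
have m22 : (6 <= m - 2)%N by exact: leq_trans nm2.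
have m20 : (0 < m - 2)%N by exact: leq_trans m22.
have m2 : (2 <= m)%N by apply: ltnW; rewrite -subn_gt0.
have m2E : (m - 2)%:R = m%:R - 2 :> R by rewrite natrB.
have mn4 : 6 * n%:R <= m%:R :> R by rewrite -natrM ler_nat.
have [lam lamE] : exists y : R, y = ln n%:R by eexists.
rewrite -lamE in hn.
have n0 : 0 < n%:R :> R by clear -n6 NV0 hN1 A0 D0 E4; lra.
have lamn : lam <= n%:R by rewrite lamE; exact: ln_le_self.
have lam1 : 1 <= lam.
  have h : e2 + e2 <= lam.
    rewrite -e2E -lnM ?posrE// lamE; apply: ln_le; first by rewrite mulr_gt0.
    by clear -n6 NV0 hN1 A0 D0 E4; lra.
  by clear -E1 h; lra.
have l0 : 0 < lam by clear -lam1; lra.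
have llam0 : 0 <= ln lam by rewrite ln_ge0.
have llamn : ln lam <= n%:R by apply: le_trans lamn; apply: ln_le_self; clear -lam1; lra.
(* The logarithm of the lower bound for r V(r), less ln 3: it gives 3 t <= r V(r), and 2 t + 1 <= 3
   t. *)
have [T TE] : exists y : R, y = (1 + b) * ((m - 2)%:R * e2) - (b - 1) * (ln lam + e2) - D by eexists.
have TA : n%:R - D <= T.
  have h1 : (1 + b) * ((4 * n%:R + 4) / 2) <= (1 + b) * ((m - 2)%:R * e2).
    rewrite ler_wpM2l//; first (clear -E4; lra).
    apply: (@le_trans _ _ ((m - 2)%:R / 2)); first by rewrite m2E; clear -mn4 n6 NV0 hN1 A0 D0 E4; lra.
    by rewrite ler_wpM2l.
  have h2 : (b - 1) * (ln lam + e2) <= (b - 1) * (n%:R + 1) by rewrite ler_wpM2l//; clear -E4 llamn E2; lra.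
  have h3 : 0 <= b * n%:R by rewrite mulr_ge0; clear -E4 n0; lra.
  by rewrite TE; clear -h1 h2 h3 E4 n0; lra.
have absA : A <= `|A| := ler_norm A.
have T1 : 10 <= T by clear -TA n6 NV0 hN1 A0 E4; lra.
have T0 : 0 < T by clear -T1; lra.
exists (expR T); first by have := expR_gt_self _ T; clear -absA TA n6 NV0 hN1 E4; lra.
have tl : ln (expR T) = T by rewrite expRK.
have [S SE] : exists y : R, ln T = y by eexists.
have S0 : 0 < S by rewrite -SE ln_gt0//; clear -T1; lra.
(* A crude power is enough, since it only enters through ln T <= 3 ln n. *)
have TB : T <= n%:R ^+ 3.
  have h1 : (1 + b) * ((m - 2)%:R * e2) <= (1 + b) * m%:R.
    rewrite ler_wpM2l//; first (clear -E4; lra).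
    apply: (@le_trans _ _ (m - 2)%:R); first by rewrite ler_piMr.
    by rewrite ler_nat leq_subr.
  have h2 : 0 <= (b - 1) * (ln lam + e2) by rewrite mulr_ge0//; clear -E4 llam0 E3; lra.
  have h3 : (1 + b) * m%:R <= n%:R * m%:R by rewrite ler_wpM2r//; clear -n6 NV0 hN1 A0 D0; lra.
  by rewrite exprS -mE; rewrite TE; clear -h1 h2 h3 D0; lra.
have S3 : S <= 3 * lam.
  by rewrite -SE; apply: (le_trans (ln_le _ _ _ T0 TB)); rewrite lnXn// lamE mulr_natl.
have lS : ln S <= ln 3 + ln lam.
  by apply: (le_trans (ln_le _ _ _ S0 S3)); rewrite lnM ?posrE.
have r20 : (0 < 2 ^ (m - 2))%N by rewrite expn_gt0.
have hp : (32 * W (2 ^ m)%N)^-1 <= p (expR T).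
  have -> : (2 ^ m = 4 * 2 ^ (m - 2))%N.
    by rewrite -[4%N]/(2 ^ 2)%N -expnD subnKC.
  apply: p_ge => //; first exact: expR_gt0.
  apply: (@le_trans _ _ (expR (T + ln 3))).
    by rewrite expRD lnK ?posrE//; have := expR_gt_self _ T; clear -T1; lra.
  have V1 := hV (m - 2)%N (leq_trans nNV nm2).
  apply: (le_trans _ (ler_wpM2l _ V1)) => //.
  rewrite -[(2 ^ (m - 2))%:R](lnK (x := _)) ?posrE ?ltr0n// -expRD ler_expR ln_exp2 e2E.
  have l2 : ln (ln (m - 2)%:R) <= ln lam + e2.
    have h : ln (m - 2)%:R <= 2 * lam.
      have -> : 2 * lam = ln m%:R by rewrite mE lnXn// lamE mulr_natl.
      by apply: ln_le; [rewrite ltr0n|rewrite ler_nat leq_subr].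
    apply: (le_trans (ln_le _ _ _ _ h)); first by rewrite ln_gt0// ltr1n; exact: leq_trans m22.
    by rewrite lnM ?posrE// e2E; clear -l0; lra.
  have h : (b - 1) * ln (ln (m - 2)%:R) <= (b - 1) * (ln lam + e2) by rewrite ler_wpM2l//; clear -E4 l2; lra.
  by rewrite TE DE; clear -h; lra.
have W0 : 0 < W (2 ^ m)%N by rewrite W_gt0// expn_gt0.
have hW : W (2 ^ m)%N <= (12 + K) * expR (b * ((m%:R + 2) * e2) - (b - 1) * ln lam).
  apply: (le_trans hn); rewrite -mulrA ler_wpM2l//; first (clear -K0; lra).
  rewrite powR_expR ?divr_gt0 ?ltr0n ?expn_gt0// ln_div ?posrE ?ltr0n ?expn_gt0// ln_exp2 e2E.
  rewrite -[X in _ * X](lnK (x := lam)) ?posrE// -expRD ler_expR.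
  have -> : m.+2%:R = m%:R + 2 :> R by rewrite -addn2 natrD.
  by rewrite le_eqVlt; apply/orP; left; apply/eqP; ring.
have rE : rate R gam kap (expR T) = expR (- gam * T + kap * ln S).
  by rewrite rateE ?tl ?SE// expR_gt0.
rewrite rE// ler_pdivlMr ?expR_gt0//.
apply: le_trans hp.
rewrite -[leRHS]div1r ler_pdivlMr ?mulr_gt0//.
have cW : 32 * W (2 ^ m)%N <= 32 * (12 + K) * expR (b * ((m%:R + 2) * e2) - (b - 1) * ln lam).
  by rewrite -mulrA ler_wpM2l.
apply: (le_trans (ler_wpM2l _ cW)).
  by rewrite mulr_ge0 ?expR_ge0// divr_ge0 ?expR_ge0// mulr_ge0//; clear -K0; lra.
set X := expR (- Q); set Y := expR (- gam * T + _); set Z := expR (b * _ - _).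
have -> : X / (32 * (12 + K)) * Y * (32 * (12 + K) * Z) = X * Y * Z.
  by field; rewrite gt_eqF//; clear -K0; lra.
rewrite /X /Y /Z -!expRD expR_le1.
have g1 : gam * ((1 + b) * ((m - 2)%:R * e2)) = b * (m%:R * e2) - 2 * (b * e2).
  transitivity (gam * (1 + b) * ((m - 2)%:R * e2)); first by ring.
  by rewrite b_gam m2E; ring.
have g2 : gam * ((b - 1) * (ln lam + e2)) = (b - 1) * ln lam - kap * ln lam + gam * (b - 1) * e2.
  transitivity (gam * (b - 1) * ln lam + gam * (b - 1) * e2); first by ring.
  by rewrite {1}g_kap; ring.
have g3 : gam * T = b * (m%:R * e2) - 2 * (b * e2) -
   ((b - 1) * ln lam - kap * ln lam + gam * (b - 1) * e2) - gam * D.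
  by rewrite -g1 -g2 TE; ring.
have g4 : kap * ln S <= kap * (ln 3 + ln lam) by rewrite ler_wpM2l ?(ltW E6).
rewrite mulNr g3 QE DE; clear -g4; lra.
Qed.

(** The surplus [eta] = theta - 3 b allows crude estimates: half of eta S absorbs ln S, the other
    half the constants and [B]. *)
Lemma liminf_infty (R : realType) (alpha b gam kap : R) (p : R -> R) (V W : nat -> R) :
  0 < alpha -> exponents R alpha b gam kap ->
  (forall r, (0 < r)%N -> 0 < W r) ->
  (forall t r, 0 < t -> (0 < r)%N -> 2 * t + 1 <= r%:R * V r ->
    (32 * W (4 * r)%N)^-1 <= p t) ->
  (exists N, forall m, (N <= m)%N ->
    ((2 ^ m)%:R / (8 * ln m%:R)) `^ b * (2 * ln m%:R) <= V (2 ^ m)%N) ->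
  (exists N, forall m, (N <= m)%N ->
    W (2 ^ m)%N <= ((2 ^ m.+1)%:R * m%:R ^+ 2) `^ b * (4 * ln m%:R)) ->
  forall theta B : R, 3 * b < theta -> exists A, forall t, A <= t ->
  B <= p t * ln t `^ theta / t `^ (- gam).
Proof.
move=> alpha0 [E4 E5 E6 E7 b_gam a_gam b_kap g_kap b_agam] W_gt0 p_ge V_ge W_le.
move=> theta B th.
have [e2 e2E] : exists e2 : R, ln 2 = e2 by exists (ln 2).
have E1 : 2^-1 <= e2 by rewrite -e2E; exact: ln2_ge.
have E2 : e2 <= 1 by rewrite -e2E; exact: ln2_le1.
have E3 : 0 < e2 by apply: lt_le_trans E1; rewrite invr_gt0.
have [NV hV] := V_ge_expR _ _ _ V_ge; rewrite e2E in hV.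
have [NW hW] := W_le.
have [eta etaE] : exists y : R, y = theta - 3 * b by eexists.
have eta0 : 0 < eta by rewrite etaE; clear -th; lra.
have ln80 : 0 <= ln 8 :> R by rewrite ln_ge0// ler1n.
have ln30 : 0 <= ln 3 :> R by rewrite ln_ge0// ler1n.
have ln83 : ln 8 = 3 * e2.
  by rewrite -e2E mulr_natl -lnXn// -natrX.
have [Q QE] : exists y : R, y = 4 * b * e2 + 2 * (b * ln 8) + e2 - ln (eta / 2) by eexists.
have [Y YE] : exists y : R, y = 8 + NV%:R + NW%:R + (b + b * ln 8 + ln 3) + `|2 / eta * (Q + 128 * `|B|)| by eexists.
exists (expR (expR Y)) => t /lnlog_large[t0 hT T0 hS].
have [T TE] : exists y : R, ln t = y by eexists.
have [S SE] : exists y : R, ln T = y by eexists.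
rewrite TE SE in hT T0 hS *.
have NV0 := ler0n R NV; have NW0 := ler0n R NW.
have bl8 : 0 <= b * ln 8 by rewrite mulr_ge0//; clear -E4; lra.
have nn0 := normr_ge0 (2 / eta * (Q + 128 * `|B|)).
have S8 : 8 + NV%:R + NW%:R <= S by rewrite YE in hS; clear -hS nn0 bl8 ln30 E4; lra.
have Sb : b + b * ln 8 + ln 3 <= S by rewrite YE in hS; clear -hS nn0 NV0 NW0; lra.
have SQ : 2 / eta * (Q + 128 * `|B|) <= S.
  by apply: (le_trans (ler_norm _)); rewrite YE in hS; clear -hS NV0 NW0 bl8 ln30 E4; lra.
have S0 : 0 < S by clear -S8 NV0 NW0; lra.
have ST : S <= T by rewrite -SE; exact: ln_le_self.
have lnSS : ln S <= S by exact: ln_le_self.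
have lnSeta : ln S <= eta / 2 * S - ln (eta / 2).
  have h : ln (eta / 2 * S) <= eta / 2 * S by apply: ln_le_self; rewrite mulr_gt0// divr_gt0.
  by rewrite lnM ?posrE ?divr_gt0// in h; clear -h; lra.
have TT : t = expR T by rewrite -TE lnK.
have ag0 : 0 <= alpha * gam * T by rewrite !mulr_ge0// ltW.
have agT : alpha * gam * T <= T.
  by rewrite a_gam ler_piMl ?(ltW T0)//; clear -E5; lra.
(* The summand [S] enlarges the radius by the factor ln t, which outweighs the logarithmic loss in V
   and costs (ln t)^b in W; [e2] makes up for rounding down. *)
have [rho rhoE] : exists y : R, y = alpha * gam * T + S + e2 by eexists.
have [m /andP[m1 m2]] : exists m : nat, m%:R * e2 <= rho < m%:R * e2 + e2.
  by rewrite -e2E; apply: exists_exp2; rewrite ?e2E; rewrite rhoE; clear -ag0 S0 E3; lra.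
have mS : S < m%:R.
  have : m%:R * e2 <= m%:R by rewrite ler_piMr.
  by rewrite rhoE in m2; clear -m2 ag0; lra.
have mNV : (NV <= m)%N by rewrite -(ler_nat R); clear -S8 mS NW0 NV0; lra.
have mNW : (NW <= m.+2)%N by rewrite -(ler_nat R) -addn2 natrD; clear -S8 mS NW0 NV0; lra.
have m8 : 8 <= m%:R :> R by clear -S8 mS NW0 NV0; lra.
have m2R : m.+2%:R = m%:R + 2 :> R by rewrite -addn2 natrD.
have mT : m.+2%:R <= 8 * T.
  have : m%:R * 2^-1 <= m%:R * e2 by rewrite ler_wpM2l.
  by rewrite m2R; rewrite rhoE in m1; clear -m1 agT ST E2 S8 NV0 NW0; lra.
have m20 : 0 < m.+2%:R :> R by rewrite ltr0n.
have lm : ln m.+2%:R <= ln 8 + S.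
  by apply: (le_trans (ln_le _ _ _ m20 mT)); rewrite lnM ?posrE// SE.
have lm2 : ln m.+2%:R <= 2 * S by clear -lm ln83 E2 S8 NV0 NW0; lra.
have lm0 : 0 < ln m.+2%:R :> R by rewrite ln_gt0// ltr1n.
have llm : ln (ln m.+2%:R) <= e2 + ln S.
  by apply: (le_trans (ln_le _ _ _ lm0 lm2)); rewrite lnM ?posrE// e2E; clear -S0; lra.
have lm0' : 0 < ln m%:R :> R by rewrite ln_gt0//; clear -m8; lra.
have llm' : ln (ln m%:R) <= e2 + ln S.
  apply: le_trans llm; apply: ln_le => //; apply: ln_le; first (clear -m8; lra).
  by rewrite ler_nat -addn2 leq_addr.
have hp : (32 * W (2 ^ m.+2)%N)^-1 <= p t.
  have -> : (2 ^ m.+2 = 4 * 2 ^ m)%N by rewrite !expnS mulnA.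
  apply: p_ge => //; first by rewrite expn_gt0.
  apply: (@le_trans _ _ (expR (T + ln 3))).
    by rewrite expRD lnK ?posrE// -TT; have := expR_gt_self _ T; rewrite -TT; clear -ST S8 NV0 NW0; lra.
  apply: (le_trans _ (ler_wpM2l _ (hV m mNV))) => //.
  rewrite -[(2 ^ m)%:R](lnK (x := _)) ?posrE ?ltr0n ?expn_gt0// -expRD ler_expR ln_exp2 e2E.
  have h1 : (1 + b) * (alpha * gam * T + S) <= (1 + b) * (m%:R * e2).
    by rewrite ler_wpM2l//; [clear -E4; lra|rewrite rhoE in m2; clear -m2; lra].
  have h2 : (1 + b) * (alpha * gam * T + S) = T + (1 + b) * S.
    transitivity ((alpha * gam + b * (alpha * gam)) * T + (1 + b) * S); first by ring.
    by rewrite b_agam a_gam; ring.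
  have h3 : (b - 1) * ln (ln m%:R) <= (b - 1) * (1 + S) by rewrite ler_wpM2l//; clear -E4 llm' E2 lnSS; lra.
  by clear -h1 h2 h3 Sb S0; lra.
have W0 : 0 < W (2 ^ m.+2)%N by rewrite W_gt0// expn_gt0.
have [Z ZE] : exists y : R, y = gam * T + b * S + 4 * b * e2 + 2 * (b * (ln 8 + S)) + e2 + ln S by eexists.
have hW2 : W (2 ^ m.+2)%N <= 4 * expR Z.
  apply: (le_trans (hW _ mNW)); rewrite mulrCA ler_wpM2l//.
  have x0 : 0 < (2 ^ m.+3)%:R * m.+2%:R ^+ 2 :> R by rewrite mulr_gt0 ?exprn_gt0// ltr0n expn_gt0.
  rewrite powR_expR// lnM ?posrE ?exprn_gt0 ?ltr0n ?expn_gt0// ln_exp2 e2E lnXn// -[ln _ *+ 2]mulr_natl.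
  rewrite -[X in _ * X](lnK (x := _)) ?posrE// -expRD ler_expR.
  have -> : m.+3%:R = m%:R + 3 :> R by rewrite -addn3 natrD.
  have h1 : b * (m%:R * e2) <= b * rho by rewrite ler_wpM2l//; clear -E4 m1; lra.
  have h2 : b * rho = gam * T + b * S + b * e2.
    by rewrite -b_agam rhoE; ring.
  have h3 : b * ln m.+2%:R <= b * (ln 8 + S) by rewrite ler_wpM2l//; clear -E4 lm; lra.
  by rewrite ZE; clear -h1 h2 h3 llm; lra.
rewrite !powR_expR// TE SE mulNr expRN invrK -mulrA -expRD.
have hp2 : (128 * expR Z)^-1 <= p t.
  apply: le_trans hp; rewrite lef_pV2 ?posrE ?mulr_gt0 ?expR_gt0//.
  by rewrite (_ : 128 = 32 * 4) -?mulrA ?ler_wpM2l// -natrM.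
apply: (le_trans _ (ler_wpM2r (expR_ge0 _) hp2)).
rewrite mulrC ler_pdivlMr ?mulr_gt0 ?expR_gt0//.
apply: (@le_trans _ _ (`|B| * (128 * expR Z))).
  by rewrite ler_wpM2r ?ler_norm// mulr_ge0 ?expR_ge0.
rewrite mulrA -ler_pdivlMr ?expR_gt0// -expRN -expRD.
apply: (@le_trans _ _ (theta * S + gam * T - Z)); last first.
  by apply/ltW/expR_gt_self.
have SQ2 : Q + 128 * `|B| <= eta / 2 * S.
  have : eta / 2 * (2 / eta * (Q + 128 * `|B|)) <= eta / 2 * S.
    by rewrite ler_wpM2l// divr_ge0// ltW.
  by rewrite (_ : eta / 2 * _ = Q + 128 * `|B|)//; field; rewrite gt_eqF.
have thS : theta * S = eta / 2 * S + eta / 2 * S + 3 * (b * S).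
  by rewrite etaE; field.
by rewrite thS ZE; rewrite QE in SQ2; clear -SQ2 lnSeta; lra.
Qed.


(** * Limits superior and inferior at infinity from pointwise estimates *)

Section LimsupPinfty.
Variable R : realType.
Implicit Type f : R -> R.

Lemma pinfty_nbhs_exists (A : set R) : pinfty_nbhs R A -> exists M, forall t, M <= t -> A t.
Proof. by move=> [M [_ hM]]; exists (M + 1) => t Mt; apply: hM; lra. Qed.

Lemma pinfty_nbhs_ge (M : R) : pinfty_nbhs R [set t | M <= t].
Proof. by exists M; split; [exact: num_real|move=> t /ltW]. Qed.

Lemma limsup_pinfty_gt0 f : (exists2 c, 0 < c & forall A, exists2 t, A <= t & c <= f t) ->
  (0 < limsup_pinfty f)%E.
Proof.
move=> [c c0 hc]; apply: (@lt_le_trans _ _ c%:E); first by rewrite lte_fin.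
apply: le_ereal_inf_tmp => _ [A /pinfty_nbhs_exists[M hM] <-].
have [t Mt ct] := hc M.
apply: (@le_trans _ _ (f t)%:E); first by rewrite lee_fin.
by apply: ereal_sup_ubound; exists t => //; exact: hM.
Qed.

Lemma limsup_pinfty_lty f : (exists C A, forall t, A <= t -> f t <= C) ->
  (limsup_pinfty f < +oo)%E.
Proof.
move=> [C [A hA]]; apply: (@le_lt_trans _ _ C%:E); last exact: ltry.
apply: ge_ereal_inf; eexists.
  by exists [set t | A <= t] => //; exact: pinfty_nbhs_ge.
by apply: ge_ereal_sup => _ [t /hA h <-]; rewrite lee_fin.
Qed.

Lemma liminf_pinfty_ge f c : (exists A, forall t, A <= t -> c <= f t) ->
  (c%:E <= liminf_pinfty f)%E.
Proof.
move=> [A hA]; rewrite /liminf_pinfty limf_einfE; apply: le_ereal_sup_tmp; eexists.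
  by exists [set t | A <= t] => //; exact: pinfty_nbhs_ge.
by apply: le_ereal_inf_tmp => _ [t /hA h <-]; rewrite lee_fin.
Qed.

Lemma liminf_pinfty_eq0 f :
  (forall eps A, 0 < eps -> exists2 t, A <= t & f t <= eps) ->
  (exists A, forall t, A <= t -> 0 <= f t) -> liminf_pinfty f = 0%E.
Proof.
move=> h1 h2; apply/eqP; rewrite eq_le (liminf_pinfty_ge _ _ h2) andbT.
apply/lee_addgt0Pr => e e0; rewrite add0e /liminf_pinfty limf_einfE.
apply: ge_ereal_sup => _ [A /pinfty_nbhs_exists[M hM] <-].
have [t Mt et] := h1 e M e0.
apply: (@le_trans _ _ (f t)%:E); last by rewrite lee_fin.
by apply: ereal_inf_lbound; exists t => //; exact: hM.
Qed.

Lemma liminf_pinfty_infty f : (forall B, exists A, forall t, A <= t -> B <= f t) ->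
  liminf_pinfty f = +oo%E.
Proof.
move=> h; apply/eqyP => B B0; exact: liminf_pinfty_ge.
Qed.

End LimsupPinfty.

Theorem mainTheorem1 (d : measure_display) (Omega : measurableType d)
  (R : realType) (P : probability Omega R) (tau : int -> Omega -> R)
  (alpha : R) :
  0 < alpha < 1 ->
  (forall x, measurable_fun setT (tau x)) ->
  mutually_independent_rvs P tau ->
  (forall x (u : R), 1 <= u ->
     P [set w | u < tau x w] = (u `^ (- alpha))%:E) ->
  {ae P, forall w,
    let p := fun t => heat_kernel (fun x => tau x w) t 0 0 in
    let phi := fun t : R => t `^ (- (1 + alpha)^-1) in
    [/\ (0 < limsup_pinfty
              (fun t => p t / (phi t * ln (ln t) `^ ((1 - alpha) / (1 + alpha))))%R)%E,
        (limsup_pinfty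
              (fun t => p t / (phi t * ln (ln t) `^ ((1 - alpha) / (1 + alpha))))%R
           < +oo)%E,
        liminf_pinfty (fun t => p t * ln t `^ ((1 + alpha)^-1) / phi t) = 0%E
      & forall theta : R, 3 / alpha < theta ->
        liminf_pinfty (fun t => p t * ln t `^ theta / phi t) = +oo%E]}.
Proof.
move=> /andP[alpha0 alpha1] mtau itau tail.
have H0 := ae_gt1 _ _ _ P _ _ mtau tail.
have H1 := ae_vol_ge _ _ _ P _ _ alpha0 alpha1 mtau itau tail.
have H2 := ae_bivol_le _ _ _ P _ _ alpha0 alpha1 mtau itau tail.
have H3 := ae_bivol_small_le _ _ _ P _ _ alpha0 alpha1 mtau itau tail.
have H4 := ae_vol_large _ _ _ P _ _ alpha0 alpha1 mtau itau tail.
have ex := exponentsP _ _ alpha0 alpha1.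
have K0 := upper_const_ge0 _ _ alpha1.
apply: filter_app H4; apply: filter_app H3.
apply: filterS3 H0 H1 H2 => w g {}H1 {}H2 {}H3 {}H4.
pose tw x := tau x w; pose p t := heat_kernel tw t 0 0.
have tw1 x : 1 <= tw x by exact/ltW/g.
have V0 r : (0 < r)%N -> 0 < vol tw r by exact: vol_gt0.
have W0 r : (0 < r)%N -> 0 < bivol tw r by exact: bivol_gt0.
have ple t r : 8 <= t -> (0 < r)%N -> p t <= 2 / vol tw r + 130 * r%:R / t.
  exact: heat_kernel_le_vol.
have pge t r : 0 < t -> (0 < r)%N -> 2 * t + 1 <= r%:R * vol tw r ->
    (32 * bivol tw (4 * r))^-1 <= p t.
  exact: heat_kernel_ge_vol.
split.
- exact/limsup_pinfty_gt0/(limsup_lower _ _ _ _ _ _ _ _ _ ex W0 K0 pge (H1 g) (H3 g)).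
- exact/limsup_pinfty_lty/(limsup_upper _ _ _ _ _ _ _ alpha0 ex V0 ple (H1 g)).
- apply: liminf_pinfty_eq0.
    exact: (liminf_zero _ _ _ _ _ _ _ ex V0 ple (fun M => H4 M g)).
  exists 0 => t t0; rewrite divr_ge0 ?powR_ge0// mulr_ge0 ?powR_ge0//.
  exact: heat_kernel_ge0.
- move=> theta th; apply: liminf_pinfty_infty => B.
  exact: (liminf_infty _ _ _ _ _ _ _ _ alpha0 ex W0 pge (H1 g) (H2 g)).
Qed.
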